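(* Let $X$ be a spectrally negative Lévy process with Lévy triplet $(\gamma,\sigma,\Pi)$ such that $\Pi$ has a strictly positive density $\pi$ on $(0,\infty)$ with respect to Lebesgue measure, and assume that $\Phi(0)=0$. Let $\Upsilon(x):=\overline{\Pi}(x)=\int_x^\infty \pi(y)\,dy$ for $x>0$. If the function $$x\mapsto \overline{\Upsilon}(x):=\int_x^\infty \Upsilon(z)\,dz$$ is log convex on $(0,\infty)$, then the $0$-scale function $W=W^{(0)}$ of $X$ is concave on $(0,\infty)$.
   Context: A spectrally negative Lévy process $X$ is a real-valued Lévy process with no positive jumps which, as usual, is not the negative of a subordinator (paths not monotone decreasing). Its triplet is $(\gamma,\sigma,\Pi)$ with $\gamma\in\mathbb{R}$, $\sigma\ge 0$, and $\Pi$ a measure on $(0,\infty)$ with $\int_0^\infty(1\wedge x^2)\Pi(dx)<\infty$ (the Lévy measure is carried by $(0,\infty)$ although jumps are negative); its Laplace exponent is $$\psi(\theta)=\log \mathbb{E}(e^{\theta X_1})=\gamma\theta+\tfrac12\sigma^2\theta^2-\int_0^\infty\left(1-e^{-\theta x}-\theta x1_{\{0<x<1\}}\right)\Pi(dx),\quad \theta\ge0.$$ $\Phi(0)\ge 0$ denotes the largest real root of $\psi$ on $[0,\infty)$ (so $\Phi(0)>0$ iff $X$ drifts to $-\infty$, iff $\psi'(0+)<0$). The $0$-scale function $W:\mathbb{R}\to[0,\infty)$ is the unique function with $W(x)=0$ for $x<0$ which on $[0,\infty)$ is continuous and non-decreasing with $\int_0^\infty e^{-\theta x}W(x)\,dx=1/\psi(\theta)$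 for $\theta>\Phi(0)$. When $\Phi(0)=0$, $\Upsilon=\overline{\Pi}$ is the Lévy density of the descending ladder height subordinator of $X$, and $\overline{\Upsilon}$ is the tail of its Lévy measure. *)

(* Defs.v *)
From HB Require Import structures.
From mathcomp Require Import all_boot all_order all_algebra.
From mathcomp Require Import all_classical all_reals all_analysis.

Set Implicit Arguments.
Unset Strict Implicit.
Unset Printing Implicit Defensive.

Import Order.TTheory GRing.Theory Num.Theory.
Import numFieldNormedType.Exports.

Local Open Scope classical_set_scope.
Local Open Scope ring_scope.

Section levy_process.
Context d (T : measurableType d) (R : realType) (P : probability T R).

(* The time set is [0, +oo[; the values of X at negative times are never
   used. *)
Implicit Types X : R -> {RV P >-> R}.

Definition cadlag (f : R -> R) : Prop :=
  (forall t, 0 <= t -> f s @[s --> t^'+] --> f t) /\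
  (forall t, 0 < t -> cvg (f s @[s --> t^'-])).

Definition independent_increments X : Prop :=
  forall (n : nat) (t : nat -> R) (B : nat -> set R),
    0 <= t 0%N ->
    (forall i, (i < n)%N -> t i <= t i.+1) ->
    (forall i, measurable (B i)) ->
    P (\bigcap_(i in `I_n) [set w | B i (X (t i.+1) w - X (t i) w)]) =
    (\prod_(i < n) P [set w | B i (X (t i.+1) w - X (t i) w)%R])%E.

Definition stationary_increments X : Prop :=
  forall s t : R, 0 <= s -> s <= t -> forall B : set R, measurable B ->
    P [set w | B (X t w - X s w)] = P [set w | B (X (t - s) w)].

Definition levy_process X : Prop :=
  [/\ {ae P, forall w, X 0 w = 0},
      {ae P, forall w, cadlag (fun t => X t w)},
      independent_increments X &
      stationary_increments X].

Definition no_positive_jumps X : Prop :=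
  {ae P, forall w, forall t, 0 < t -> X t w <= lim (X s w @[s --> t^'-])}.

Definition neg_subordinator X : Prop :=
  {ae P, forall w, forall s t, 0 <= s -> s <= t -> X t w <= X s w}.

Definition spectrally_negative_levy X : Prop :=
  [/\ levy_process X, no_positive_jumps X & ~ neg_subordinator X].

Definition process_laplace_exponent X (theta : R) : \bar R :=
  lne 'E_P[fun w => expR (theta * X 1%R w)%R]%E.

End levy_process.

Section triplet.
Context (R : realType).
Implicit Types (gamma sigma theta x Phi : R) (pi psi W : R -> R).
Implicit Types (Pi : {measure set (measurableTypeR R) -> \bar R}).

Definition levy_measure Pi : Prop :=
  Pi `]-oo, 0]%classic = 0%E /\
  (\int[Pi]_(x in `]0%R, +oo[) (Num.min 1 (x ^+ 2))%:E < +oo)%E.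

Definition triplet_exponent gamma sigma Pi theta : R :=
  gamma * theta + 2^-1 * sigma ^+ 2 * theta ^+ 2
  - \int[Pi]_(x in `]0, +oo[)
      (1 - expR (- (theta * x)) - theta * x * \1_`]0, 1[ x).

(* The Laplace exponent on [0, +oo[ determines the law of X, so this relation
   says that (gamma, sigma, Pi) is the triplet of X. *)
Definition has_triplet d (T : measurableType d) (P : probability T R)
    (X : R -> {RV P >-> R}) gamma sigma Pi : Prop :=
  [/\ 0 <= sigma, levy_measure Pi &
      forall theta, 0 <= theta ->
        process_laplace_exponent X theta =
        (triplet_exponent gamma sigma Pi theta)%:E].

Definition positive_density Pi pi : Prop :=
  [/\ measurable_fun (`]0, +oo[%classic : set (measurableTypeR R)) pi,
      forall x, 0 < x -> 0 < pi x &
      forall A : set (measurableTypeR R), measurable A -> A `<=` `]0, +oo[ ->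
        Pi A = (\int[lebesgue_measure]_(x in A) (pi x)%:E)%E].

Definition largest_root psi Phi0 : Prop :=
  [/\ 0 <= Phi0, psi Phi0 = 0 &
      forall theta, 0 <= theta -> psi theta = 0 -> theta <= Phi0].

Definition scale_function psi Phi0 W : Prop :=
  [/\ forall x, 0 <= W x,
      forall x, x < 0 -> W x = 0,
      {within `[0, +oo[, continuous W},
      {in `[0, +oo[ &, {homo W : x y / x <= y}} &
      forall theta, Phi0 < theta ->
        (\int[lebesgue_measure]_(x in `[0%R, +oo[)
            (expR (- (theta * x)) * W x)%:E)%E = (psi theta)^-1%:E].

Definition Upsilon pi x : R := \int[lebesgue_measure]_(y in `]x, +oo[) pi y.

Definition Upsilon_bar pi x : R :=
  \int[lebesgue_measure]_(z in `]x, +oo[) Upsilon pi z.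

(* Since [ln] is total on R, positivity has to be required. It also rules out
   the value 0 that a divergent real-valued integral would take. *)
Definition log_convex_on (D : set R) (f : R -> R) : Prop :=
  (forall x, D x -> 0 < f x) /\ convex_function D (fun x => ln (f x)).

Definition concave_on (D : set R) (f : R -> R) : Prop :=
  convex_function D (fun x => - f x).

End triplet.

(* Main.v *)
(** Write [psi l = l^2 F l], where [F l = delta + kappa / l + L(l)], [L] is the
    Laplace transform of the tail [Upsilon_bar], [delta = sigma^2 / 2] and
    [kappa = psi'(0+) >= 0]; the Laplace transform of [W] is then
    [1 / (l^2 F l)]. Expanding at [n - s] in powers of [s], the coefficients of
    [F] form a log-convex sequence, because [Upsilon_bar] is log-convex, so by
    Kaluza's theorem [1 / F] has nonpositive coefficients except for the first
    one. As the factor [(n - s)^2] acts as a second difference, the Gamma means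
    [n^(k+1) / k! \int x^k e^(-n x) W(x) dx] are concave in [k]. For
    [k = floor (n x)] they converge to [W x] as [n] grows. *)

From HB Require Import structures.
Require Import Defs.
From mathcomp Require Import all_boot all_order all_algebra.
From mathcomp Require Import all_classical all_reals all_analysis.
From mathcomp Require Import measurable_realfun.
From mathcomp Require Import ring lra.
Import Order.TTheory GRing.Theory Num.Theory.
Import numFieldNormedType.Exports.
Local Open Scope classical_set_scope.
Local Open Scope ring_scope.

Set Implicit Arguments.
Unset Strict Implicit.

(** * Kaluza's theorem and truncated expansions *)

(** The moments carry the factor 1 / k!, so Cauchy-Schwarz, which makes \int x^k e^(-l x) g(x) dx
    log-convex in k, is too weak: for an exponential g the normalised moments are exactly geometric,
    and log-convexity has to come from comparing g with an exponential. It is tested through b_(k+2)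
    - 2 t b_(k+1) + t^2 b_k >= 0, which is linear in b, so that the three terms of F can be treated
    separately. The shape of F comes from e^(-l x) - 1 + l x = l^2 \int_0^x e^(-l z) (x - z) dz,
    integrated against Pi. The sign of kappa comes from psi(l) / l -> kappa as l decreases to 0,
    where psi > 0 because 1 / psi is the transform of W >= 0 and psi has no positive root.
    Expansions in s are polynomials with an error O(s^N) on 0 < s <= n / 2. Kaluza's argument uses
    finitely many coefficients at a time, so no power series has to be multiplied or inverted. The
    limit in n is a law of large numbers; it needs a growth bound on W, which is read off from its
    transform. *)

Lemma log_convex_ratio (R : realFieldType) (b : nat -> R) :
  (forall k, 0 < b k) -> (forall k, b k.+1 ^+ 2 <= b k * b k.+2) ->
  forall m n, (m <= n)%N -> b m.+1 * b n <= b n.+1 * b m.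
Proof.
move=> b0 bc m n /subnK <-; elim: (n - m)%N => [|i IH]; first by rewrite add0n.
rewrite addSn; set l := (i + m)%N in IH *.
rewrite -(ler_pM2r (b0 l)) mulrAC (le_trans (ler_wpM2r (ltW (b0 _)) IH))//.
by rewrite mulrAC [leRHS]mulrAC ler_wpM2r ?(ltW (b0 m))// -expr2 mulrC.
Qed.

(* Kaluza's theorem: scaling the vanishing k-th convolution so that it cancels
   the leading term of the next one leaves coefficients whose signs follow from
   the monotonicity of [b k.+1 / b k]. *)
Lemma kaluza (R : realFieldType) (N : nat) (b v : nat -> R) :
  (forall k, 0 < b k) -> (forall k, b k.+1 ^+ 2 <= b k * b k.+2) ->
  0 <= v 0%N ->
  (forall k, (k < N)%N -> \sum_(j < k.+2) b (k.+1 - j)%N * v j = 0) ->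
  forall k, (k < N)%N -> v k.+1 <= 0.
Proof.
move=> b0 bc v0 bv k; elim/ltn_ind: k => -[|k] IH kN.
  have := bv 0%N kN; rewrite !big_ord_recl big_ord0 /= addr0 => /eqP.
  rewrite addrC addr_eq0 subnn => /eqP e.
  by rewrite -(pmulr_rle0 _ (b0 0%N)) e oppr_le0 mulr_ge0// ltW.
have e1 := bv _ (ltnW kN); have e2 := bv _ kN.
rewrite big_ord_recr /= subnn in e2.
have -> : v k.+2 = - (b 0%N)^-1 * \sum_(j < k.+2) b (k.+2 - j)%N * v j.
  have b00 : b 0%N != 0 by rewrite gt_eqF.
  apply: (mulfI b00); rewrite mulrA mulrN divff// mulN1r.
  by apply/eqP; rewrite -addr_eq0 addrC e2.
rewrite mulNr oppr_le0 mulr_ge0 ?invr_ge0 ?(ltW (b0 _))//.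
rewrite -(pmulr_rge0 _ (b0 k.+1)) mulr_sumr.
have := congr1 (fun x => b k.+2 * x) e1; rewrite /= mulr0 mulr_sumr => e3.
rewrite -[leRHS]subr0 -[X in _ - X]e3 -sumrB sumr_ge0// => -[[|j] jk] _ /=.
  by rewrite !subn0 mulrCA !mulrA mulrAC subrr.
rewrite !mulrA -mulrBl mulr_le0 ?IH//; last first.
  by rewrite !ltnS in jk; rewrite (leq_ltn_trans jk)// ltnW.
have jk' : (j <= k)%N by rewrite !ltnS in jk.
rewrite subr_le0 mulrC.
have -> : (k.+2 - j.+1 = (k - j).+1)%N by rewrite subSS subSn.
rewrite [(k.+1 - j.+1)%N]subSS.
by apply: log_convex_ratio => //; rewrite (leq_trans (leq_subr _ _)).
Qed.

(** The increments are nonincreasing, so the rise from [j] to [l] is at most [l - j] times the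
    increment at [j] ([up]), and the rise from [i] to [j] at least [j - i] times it ([dn]).
    Eliminating that increment leaves a three-point form, which survives a limit in which the
    indices move. *)
Lemma concave_seq (R : realFieldType) (w : nat -> R) :
  (forall k, w k.+2 - 2 * w k.+1 + w k <= 0) ->
  forall i j l, (i <= j)%N -> (j <= l)%N ->
  (l%:R - j%:R) * w i + (j%:R - i%:R) * w l <= (l%:R - i%:R) * w j.
Proof.
Proof.
move=> wc; have wd p q : (p <= q)%N -> w q.+1 - w q <= w p.+1 - w p.
  move=> /subnK <-; elim: (q - p)%N => [|n IH]; first by rewrite add0n.
  by rewrite addSn (le_trans _ IH)//; have := wc (n + p)%N; lra.
have up j n : w (n + j)%N - w j <= n%:R * (w j.+1 - w j).
  elim: n => [|n IH]; first by rewrite add0n subrr mul0r.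
  have := wd j (n + j)%N (leq_addl _ _); rewrite addSn -natr1 mulrDl mul1r; lra.
have dn i n : n%:R * (w (n + i).+1 - w (n + i)%N) <= w (n + i)%N - w i.
  elim: n => [|n IH]; first by rewrite add0n subrr mul0r.
  have := wc (n + i)%N; rewrite addSn -natr1 => h.
  have := ler_wpM2l (ler0n R n) (wd _ _ (leqnSn (n + i)%N)); lra.
move=> i j l /subnK <- /subnK <-; move: (j - i)%N => m.
move: (l - _)%N => n; rewrite !natrD.
have := ler_wpM2l (ler0n R m) (up (m + i)%N n).
have := ler_wpM2l (ler0n R n) (dn i m).
nra.
Qed.

(** Turns a bound O(s^N) near 0 into exact equations between coefficients. The constant term must
    vanish, since it dominates for small [s]; dividing by [s] then lowers [N] by one. *)
Lemma poly_small (R : realFieldType) (C r : R) (N : nat) (p : {poly R}) :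
  0 < r -> (forall s, 0 < s -> s <= r -> `|p.[s]| <= C * s ^+ N) ->
  forall k, (k < N)%N -> p`_k = 0.
Proof.
move=> r0; elim: N p => // N IH p pC.
have [q [c pE]] : exists q c, p = q * 'X + c%:P :> {poly R}.
  by elim/poly_ind: p {pC} => [|q c _]; [exists 0, 0; rewrite mul0r addr0|exists q, c].
rewrite {}pE in pC *; have c0 : c = 0.
  apply/eqP/contraT => cn0; pose K := `|C| + \sum_(i < size q) `|q`_i|.
  have K0 : 0 <= K by rewrite addr_ge0// sumr_ge0.
  (* For [s <= 1] the estimates below give [|c| <= K * s], whereas this choice makes
     [2 * (K + 1) * s <= |c|]. *)
  pose s := Num.min (Num.min r 1) (`|c| / (K + 1) / 2).
  have K1 : 0 < K + 1 by lra.
  have s0 : 0 < s by rewrite !lt_min r0 ltr01 !divr_gt0// normr_gt0.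
  have s1 : s <= 1 by rewrite !ge_min lexx orbT.
  have sr : s <= r by rewrite !ge_min lexx.
  have qs : `|q.[s]| <= \sum_(i < size q) `|q`_i|.
    rewrite horner_coef (le_trans (ler_norm_sum _ _ _))// ler_sum// => i _.
    by rewrite normrM ler_piMr// normrX exprn_ile1// ger0_norm// ltW.
  have sN : s ^+ N <= 1 by rewrite exprn_ile1// ltW.
  have sN0 : 0 <= s ^+ N by rewrite exprn_ge0// ltW.
  have := pC s s0 sr; rewrite hornerMXaddC.
  have : `|c| <= `|q.[s] * s + c| + `|q.[s]| * s.
    have -> : `|q.[s]| * s = `|q.[s] * s| by rewrite normrM (gtr0_norm s0).
    rewrite -{1}(addrK (q.[s] * s) c) [c + _]addrC.
    exact: ler_normB.
  have : C * s ^+ N.+1 <= `|C| * s.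
    rewrite exprS mulrCA mulrC ler_wpM2r ?(ltW s0)//.
    by rewrite (le_trans (ler_norm _))// normrM (ger0_norm sN0) ler_piMr.
  have := ler_wpM2r (ltW s0) qs.
  have : s <= `|c| / (K + 1) / 2 by rewrite ge_min lexx orbT.
  rewrite ler_pdivlMr// ler_pdivlMr// => h1 h2 h3 h4 h5.
  have : `|c| <= K * s by rewrite /K mulrDl; lra.
  by have := mulr_ge0 K0 (ltW s0); lra.
move: pC; rewrite c0 addr0 => pC [|k] kN; rewrite coefMX//=.
apply: IH => // s s0 sr; have := pC s s0 sr.
by rewrite hornerMX normrM (gtr0_norm s0) exprSr mulrA ler_pM2r.
Qed.

(* The analytic input is a pair of truncated expansions [a], [b] of the
   factors of [A * B = 1 / c]; only coefficients below the truncation order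
   are determined. *)
Lemma coef_inverse_expansion (R : realFieldType) (N : nat) (r C : R)
    (A B : R -> R) (a b c : {poly R}) : 0 < r ->
  (forall s, 0 < s -> s <= r -> `|A s - a.[s]| <= C * s ^+ N) ->
  (forall s, 0 < s -> s <= r -> `|B s - b.[s]| <= C * s ^+ N) ->
  (forall s, 0 < s -> s <= r -> c.[s] * A s * B s = 1) ->
  forall k, (k < N)%N -> (a * (c * b))`_k = (k == 0%N)%:R.
Proof.
move=> r0 hA hB hC k kN; apply/eqP; rewrite -subr_eq0 -coef1 -coefB; apply/eqP.
have polyB (p : {poly R}) :
    exists2 K, 0 <= K & forall s, 0 < s -> s <= r -> `|p.[s]| <= K.
  exists (\sum_(i < size p) `|p`_i| * r ^+ i).
    by apply: sumr_ge0 => i _; rewrite mulr_ge0// exprn_ge0// ltW.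
  move=> s s0 sr; rewrite horner_coef (le_trans (ler_norm_sum _ _ _))// ler_sum// => i _.
  by rewrite normrM ler_wpM2l// normrX gtr0_norm// lerXn2r// nnegrE ltW.
have [Ka Ka0 ha] := polyB a; have [Kb Kb0 hb] := polyB b.
have [Kc Kc0 hc] := polyB c.
pose K := Kc * (Ka + `|C| * r ^+ N + Kb) * `|C|.
apply: (@poly_small _ K r N) => // s s0 sr; have := hC s s0 sr => e.
have -> : (a * (c * b) - 1).[s] =
    a.[s] * (c.[s] * b.[s]) - c.[s] * A s * B s by rewrite e !hornerE.
have -> : a.[s] * (c.[s] * b.[s]) - c.[s] * A s * B s =
  - (c.[s] * ((A s - a.[s]) * b.[s] + A s * (B s - b.[s]))) by ring.
rewrite normrN normrM /K -!mulrA ler_pM//; first exact: hc.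
have sN0 : 0 <= s ^+ N by rewrite exprn_ge0// ltW.
have CsN : C * s ^+ N <= `|C| * s ^+ N by rewrite ler_wpM2r// ler_norm.
have dA := le_trans (hA s s0 sr) CsN; have dB := le_trans (hB s s0 sr) CsN.
have As : `|A s| <= Ka + `|C| * r ^+ N.
  rewrite -(subrK a.[s] (A s)) addrC (le_trans (ler_normD _ _))// lerD//.
    exact: ha.
  by rewrite (le_trans dA)// ler_wpM2l// lerXn2r// nnegrE ltW.
rewrite (le_trans (ler_normD _ _))// !normrM mulrDl addrC lerD//.
  exact: ler_pM.
by rewrite mulrC ler_pM// hb.
Qed.

(** * Gamma kernels and moments *)

Section moments.
Context {R : realType}.
Local Notation mu := (@lebesgue_measure R).
Local Notation D := (`]0%R, +oo[%classic : set (measurableTypeR R)).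
Implicit Types (g : R -> R) (l s t x : R) (k n N : nat).

Lemma in_posP x : x \in D -> 0 < x.
Proof. by rewrite inE/= in_itv/= andbT. Qed.

Lemma posP x : D x -> 0 < x.
Proof. by rewrite /= in_itv/= andbT. Qed.

Lemma measurable_pos : measurable D.
Proof. exact: measurable_itv. Qed.

Lemma expR_ge_psum x N : 0 <= x -> \sum_(k < N) x ^+ k / k`!%:R <= expR x.
Proof.
move=> x0; rewrite -(big_mkord xpredT (fun k => x ^+ k / k`!%:R)).
apply: (@nondecreasing_cvgn_le _ (series (exp_coeff x))).
  apply/nondecreasing_seqP => n; rewrite /series/= big_nat_recr//= lerDl.
  exact: exp_coeff_ge0.
exact: is_cvg_series_exp_coeff.
Qed.

Lemma expR_ge_term x k : 0 <= x -> x ^+ k / k`!%:R <= expR x.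
Proof.
move=> x0; apply: le_trans (expR_ge_psum k.+1 x0).
rewrite big_ord_recr/= lerDr sumr_ge0// => i _.
by rewrite divr_ge0// exprn_ge0.
Qed.

(* The remainder of order [N] at [q * x] is a series with nonnegative terms
   dominated by [q ^+ N] times that of [x]. *)
Lemma expR_remainder q x N : 0 <= q -> q <= 1 -> 0 <= x ->
  0 <= expR (q * x) - \sum_(k < N) (q * x) ^+ k / k`!%:R <= q ^+ N * expR x.
Proof.
move=> q0 q1 x0; have qx0 : 0 <= q * x by rewrite mulr_ge0.
rewrite subr_ge0 expR_ge_psum//= lerBlDr.
apply: limr_le; first exact: is_cvg_series_exp_coeff.
near=> n; have Nn : (N <= n)%N by near: n; exists N.
rewrite /series/= (big_cat_nat (leq0n N) Nn)/= big_mkord addrC lerD2r.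
apply: (@le_trans _ _ (\sum_(N <= k < n) q ^+ N * exp_coeff x k)).
  apply: ler_sum_nat => k /andP[Nk _]; rewrite /exp_coeff/= mulrA.
  rewrite ler_wpM2r ?invr_ge0// exprMn ler_wpM2r ?exprn_ge0//.
  by rewrite ler_wiXn2l.
rewrite -mulr_sumr ler_wpM2l ?exprn_ge0//.
apply: le_trans (expR_ge_psum n x0).
rewrite -(big_mkord xpredT (fun k => x ^+ k / k`!%:R)).
rewrite [leRHS](big_cat_nat (leq0n N) Nn)/= lerDr sumr_ge0// => i _.
exact: exp_coeff_ge0.
Unshelve. all: by end_near. Qed.

Definition kern k l x : R := x ^+ k / k`!%:R * expR (- (l * x)).

(** With the factor 1 / k! in [kern], this is the coefficient of s^k in the Laplace transform of [g]
    at [l - s], that is, (-1)^k / k! times its k-th derivative at [l]. *)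
Definition mom g l k : R := \int[mu]_(x in D) (kern k l x * g x).

Definition laplace_finite g : Prop :=
  [/\ measurable_fun D g, forall x, 0 < x -> 0 <= g x &
      forall l, 0 < l ->
        (\int[mu]_(x in D) (expR (- (l * x)) * g x)%:E < +oo)%E].

Lemma kern_ge0 k l x : 0 <= x -> 0 <= kern k l x.
Proof. by move=> x0; rewrite mulr_ge0 ?expR_ge0// divr_ge0// exprn_ge0. Qed.

Lemma kern0 l x : kern 0 l x = expR (- (l * x)).
Proof. by rewrite /kern expr0 divr1 mul1r. Qed.

(** Half of the exponential absorbs the power, by y^k / k! <= e^y at y = l x / 2. A finite Laplace
    transform at [l / 2] thus gives all moments at [l]. *)
Lemma kern_le k l x : 0 < l -> 0 <= x ->
  kern k l x <= (2 / l) ^+ k * expR (- (l / 2 * x)).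
Proof.
move=> l0 x0; have l20 : 0 < l / 2 by rewrite divr_gt0.
have -> : kern k l x =
    (2 / l) ^+ k * ((l / 2 * x) ^+ k / k`!%:R * expR (- (l * x))).
  rewrite /kern mulrA mulrA -exprMn; congr (_ ^+ _ / _ * _).
  by field; rewrite gt_eqF.
rewrite ler_wpM2l// ?exprn_ge0 ?divr_ge0// ?(ltW l0)//.
rewrite [in leRHS](_ : - (l / 2 * x) = l / 2 * x + - (l * x)); last by field.
by rewrite expRD ler_wpM2r ?expR_ge0// expR_ge_term// mulr_ge0// ltW.
Qed.

Lemma measurable_kern k l : measurable_fun D (kern k l).
Proof.
apply: measurable_funM.
  by apply: measurable_funM => //; exact: measurable_funX.
by apply: measurableT_comp => //; apply: measurable_funN; exact: measurable_funM.
Qed.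

Lemma integrable_kern g k l : laplace_finite g -> 0 < l ->
  mu.-integrable D (EFin \o (fun x => kern k l x * g x)).
Proof.
move=> [mg g0 gl] l0.
have mk j m : measurable_fun D (EFin \o (fun x => kern j m x * g x)).
  by apply/measurable_EFinP/measurable_funM => //; exact: measurable_kern.
have l20 : 0 < l / 2 by rewrite divr_gt0.
have i0 : mu.-integrable D (EFin \o (fun x => kern 0 (l / 2) x * g x)).
  apply/integrableP; split => //.
  under eq_integral => x /in_posP x0.
    rewrite /= kern0 ger0_norm ?mulr_ge0 ?expR_ge0 ?g0//.
    over.
  exact: gl.
apply: (le_integrable measurable_pos (mk k l)); last first.
  exact: (integrableZl measurable_pos ((2 / l) ^+ k) i0).
move=> x /posP x0 /=; have := g0 _ x0 => gx.
have x0' := ltW x0; have l2 : 0 <= 2 / l by rewrite divr_ge0// ltW.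
rewrite lee_fin !ger0_norm ?mulr_ge0 ?kern_ge0 ?exprn_ge0//.
by rewrite mulrA ler_wpM2r// kern0 kern_le// ltW.
Qed.

Lemma mom_ge0 g l k : laplace_finite g -> 0 <= mom g l k.
Proof.
move=> [_ g0 _]; apply: Rintegral_ge0 => x /posP x0.
by rewrite mulr_ge0 ?g0// kern_ge0// ltW.
Qed.

(** Expand e^(s x) under the integral. With r = l / 2, [expR_remainder] at the ratio s / r bounds
    the remainder by (s / r)^N e^(r x), and e^(r x) e^(-l x) = e^(-r x) is still integrable against
    [g]. *)
Lemma mom_expansion g l N : laplace_finite g -> 0 < l ->
  exists C, forall s, 0 < s -> s <= l / 2 ->
    `|mom g (l - s) 0 - \sum_(k < N) mom g l k * s ^+ k| <= C * s ^+ N.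
Proof.
move=> gl l0; have [mg g0 _] := gl; set r := l / 2.
have r0 : 0 < r by rewrite divr_gt0.
exists (r^-1 ^+ N * mom g r 0) => s s0 sr.
have ls : 0 < l - s by rewrite /r in sr; lra.
have sumE : \sum_(k < N) mom g l k * s ^+ k =
    \int[mu]_(x in D) (\sum_(k < N) s ^+ k * (kern k l x * g x)) /\
    mu.-integrable D (EFin \o (fun x => \sum_(k < N) s ^+ k * (kern k l x * g x))).
  elim: N => [|N [IH iH]].
    rewrite big_ord0; split.
      under eq_Rintegral do rewrite big_ord0.
      by rewrite Rintegral_cst// mul0r.
    apply: eq_integrable (integrable0 mu D) => // x _.
    by rewrite /= big_ord0.
  have iN : mu.-integrable D (EFin \o (fun x => s ^+ N * (kern N l x * g x))).
    exact: (integrableZl measurable_pos _ (integrable_kern N gl l0)).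
  split.
    under eq_Rintegral do rewrite big_ord_recr/=.
    rewrite RintegralD// big_ord_recr/= IH mulrC RintegralZl//.
    exact: integrable_kern.
  apply: eq_integrable (integrableD measurable_pos iH iN) => // x _.
  by rewrite /= big_ord_recr/= EFinD.
have [-> iS] := sumE; have i1 := integrable_kern 0 gl ls.
rewrite /mom -RintegralB//.
have ir := integrable_kern 0 gl r0.
rewrite mulrAC -exprMn -RintegralZl//.
have iB := integrableB measurable_pos i1 iS.
apply: (le_trans (le_normr_Rintegral measurable_pos iB)).
apply: le_Rintegral => //.
- exact: (integrable_norm iB).
- exact: (integrableZl measurable_pos _ ir).
move=> x /posP x0; rewrite !kern0.
have -> : expR (- ((l - s) * x)) * g x - \sum_(k < N) s ^+ k * (kern k l x * g x)
  = (expR (s / r * (r * x)) - \sum_(k < N) (s / r * (r * x)) ^+ k / k`!%:R)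
    * expR (- (l * x)) * g x.
  rewrite !mulrBl; congr (_ - _).
    congr (_ * _); rewrite -expRD; congr expR.
    by field; rewrite gt_eqF.
  rewrite !mulr_suml; apply: eq_bigr => k _.
  by rewrite /kern [s / r * _]mulrA divfK ?gt_eqF// exprMn; ring.
have rx : 0 <= r * x by rewrite mulr_ge0// ltW.
have sr0 : 0 <= s / r by rewrite divr_ge0// ltW.
have sr1 : s / r <= 1 by rewrite ler_pdivrMr// mul1r.
have /andP[h1 h2] := expR_remainder N sr0 sr1 rx.
rewrite ger0_norm ?mulr_ge0 ?expR_ge0 ?g0//.
rewrite [leRHS]mulrA ler_wpM2r ?g0//.
apply: (le_trans (ler_wpM2r (expR_ge0 _) h2)).
rewrite -mulrA -expRD [r^-1 * s]mulrC ler_wpM2l ?exprn_ge0//.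
by rewrite ler_expR /r; lra.
Qed.

End moments.

(** * Log-convexity of the moments *)

Section exponential_comparison.
Context {R : realType}.
Local Notation mu := (@lebesgue_measure R).
Local Notation D := (`]0%R, +oo[%classic : set (measurableTypeR R)).
Implicit Types (g : R -> R) (c l t x : R) (k n N : nat).

(** Integration by parts: the derivative of [kern k.+1 l] is [kern k l - l * kern k.+1 l]. This
    primitive vanishes at infinity, so the integral over the half-line is minus its value at 0. *)
Fixpoint kern_primitive l k x : R :=
  if k is n.+1 then (kern_primitive l n x - kern k l x) / l
  else - kern 0 l x / l.

Lemma is_derive_kern0 l x : is_derive x 1 (kern 0 l) (- l * kern 0 l x).
Proof.
have -> : kern 0 l = (fun y => expR (- l * y)).
  by apply/funext => y; rewrite kern0 mulNr.
by apply: is_derive_eq; rewrite /GRing.scale /=; ring.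
Qed.

Lemma is_derive_kernS k l x :
  is_derive x 1 (kern k.+1 l) (kern k l x - l * kern k.+1 l x).
Proof.
have kE : kern k.+1 l = k.+1`!%:R^-1 \*: (id ^+ k.+1 * kern 0 l)%R.
  apply/funext => y.
  rewrite -[RHS]/(k.+1`!%:R^-1 * ((id ^+ k.+1 : R -> R) y * kern 0 l y)).
  by rewrite kern0 exprfctE /kern; ring.
have d0 := is_derive_kern0 l x; rewrite {1}kE.
apply: is_derive_eq; rewrite kern0 /kern factS natrM /GRing.scale/=.
have -> : (id ^+ k.+1 : R -> R) x = x ^+ k.+1 by rewrite exprfctE.
by field; rewrite nat1r !pnatr_eq0 -lt0n fact_gt0.
Qed.

Lemma is_derive_kern_primitive l k x : 0 < l ->
  is_derive x 1 (kern_primitive l k) (kern k l x).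
Proof.
move=> l0; have ln0 : l != 0 by rewrite gt_eqF.
elim: k => [|k IH] /=.
  have d0 := is_derive_kern0 l x.
  by apply: is_derive_eq; rewrite /GRing.scale/=; field.
have dS := is_derive_kernS k l x.
by apply: is_derive_eq; rewrite /GRing.scale/=; field.
Qed.

Lemma expRN_cvgy l : 0 < l -> expR (- (l * x)) @[x --> +oo] --> (0 : R).
Proof.
move=> l0.
apply: (@cvg_comp _ _ _ (fun x : R => l * x) (fun y : R => expR (- y))
  (pinfty_nbhs R) (pinfty_nbhs R)); last exact: cvgr_expR.
exact: (gt0_cvgMry l0 (@cvg_id _ _)).
Qed.

Lemma kern_cvgy k l : 0 < l -> kern k l x @[x --> +oo] --> (0 : R).
Proof.
move=> l0.
apply: (@squeeze_cvgr _ _ _ _ (fun=> 0)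
  (fun x => (2 / l) ^+ k * expR (- (l / 2 * x)))).
- near=> x; have x0 : 0 <= x by near: x; exact: nbhs_pinfty_ge.
  by rewrite kern_ge0//= kern_le.
- exact: cvg_cst.
have l20 : 0 < l / 2 by rewrite divr_gt0.
have /(_ _ _) := cvgM (cvg_cst ((2 / l) ^+ k)) (expRN_cvgy l20).
by rewrite mulr0.
Unshelve. all: by end_near. Qed.

Lemma kern_primitive_cvgy k l : 0 < l ->
  kern_primitive l k x @[x --> +oo] --> (0 : R).
Proof.
move=> l0; elim: k => [|k IH] /=.
  have /(_ _ _ _) := cvgM (cvgN (kern_cvgy 0 l0)) (cvg_cst l^-1).
  by rewrite oppr0 mul0r.
have /(_ _ _ _) := cvgM (cvgB IH (kern_cvgy k.+1 l0)) (cvg_cst l^-1).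
by rewrite subr0 mul0r.
Qed.

Lemma kern_primitive0 k l : 0 < l -> kern_primitive l k 0 = - (l ^+ k.+1)^-1.
Proof.
move=> l0; have ln0 : l != 0 by rewrite gt_eqF.
elim: k => [|k /= ->] /=.
  by rewrite /kern mulr0 oppr0 expR0 expr0 divr1 mul1r expr1 mulN1r.
rewrite {1}/kern expr0n/= !mul0r subr0 [in RHS]exprS.
by rewrite invfM mulNr mulrC.
Qed.

Lemma integral_kern k l : 0 < l ->
  (\int[mu]_(x in D) (kern k l x)%:E = (l ^+ k.+1)^-1%:E)%E.
Proof.
move=> l0; have dP x := is_derive_kern_primitive k x l0.
rewrite integral_itv_obnd_cbnd; last first.
  by apply/measurable_EFinP; exact: measurable_kern.
have ck : continuous (kern k l).
  move=> x; apply/differentiable_continuous/derivable1_diffP.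
  case: k {dP} => [|k]; [have := is_derive_kern0 l x|have := is_derive_kernS k l x];
    by case.
rewrite (@ge0_continuous_FTC2y _ _ (kern_primitive l k) _ 0).
- by rewrite kern_primitive0// EFinN oppeK add0e.
- by move=> x x0; exact: kern_ge0.
- exact: continuous_subspaceT.
- exact: kern_primitive_cvgy.
- by move=> x _; have [] := dP x.
- apply: cvg_at_right_filter; apply/differentiable_continuous/derivable1_diffP.
  by have [] := dP 0.
- by move=> x _; rewrite derive1E; have /@derive_val := dP x.
Qed.

(** The rate [l = 0] is included so that constants are covered: [kappa / l] is the transform of the
    constant [kappa]. *)
Lemma laplace_finite_exp c l : 0 <= c -> 0 <= l ->
  laplace_finite (fun x => c * expR (- (l * x))).
Proof.
move=> c0 l0.
have mE a : measurable_fun D (fun x : R => expR (- (a * x))).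
  apply: eq_measurable_fun (@measurable_kern R 0 a) => x _.
  by rewrite kern0.
split; first by apply: measurable_funM => //; exact: mE.
  by move=> x _; rewrite mulr_ge0// expR_ge0.
move=> a a0; have al : 0 < a + l by rewrite ltr_wpDr.
under eq_integral.
  move=> x _.
  rewrite (_ : _ * _ = c * kern 0 (a + l) x); last first.
    by rewrite kern0 mulrCA -expRD; congr (_ * expR _); ring.
  rewrite EFinM; over.
rewrite ge0_integralZl_EFin//.
- by rewrite integral_kern// -EFinM ltry.
- by move=> x /posP x0; rewrite lee_fin kern_ge0// ltW.
- by apply/measurable_EFinP; exact: measurable_kern.
Qed.

Lemma mom_exp c l a k : 0 <= c -> 0 <= a -> 0 < l ->
  mom (fun x => c * expR (- (a * x))) l k = c / (l + a) ^+ k.+1.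
Proof.
move=> c0 a0 l0; have la : 0 < l + a by rewrite ltr_wpDr.
rewrite /mom /Rintegral.
under eq_integral.
  move=> x _.
  rewrite (_ : _ * _ = c * kern k (l + a) x); last first.
    by rewrite /kern mulrDl opprD expRD; ring.
  rewrite EFinM; over.
rewrite ge0_integralZl_EFin//.
- by rewrite integral_kern.
- by move=> x /posP x0; rewrite lee_fin kern_ge0// ltW.
- by apply/measurable_EFinP; exact: measurable_kern.
Qed.

Lemma mom_quad g l t k : laplace_finite g -> 0 < l ->
  mom g l k.+2 - 2 * t * mom g l k.+1 + t ^+ 2 * mom g l k =
  \int[mu]_(x in D) ((kern k.+2 l x - 2 * t * kern k.+1 l x
     + t ^+ 2 * kern k l x) * g x) /\
  mu.-integrable D (EFin \o (fun x => (kern k.+2 l x - 2 * t * kern k.+1 l x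
     + t ^+ 2 * kern k l x) * g x)).
Proof.
move=> gl l0; have i2 := integrable_kern k.+2 gl l0.
have i1 := integrable_kern k.+1 gl l0; have i0 := integrable_kern k gl l0.
have m := @measurable_pos R.
have i1' : mu.-integrable D (EFin \o (fun x => 2 * t * (kern k.+1 l x * g x))).
  exact: (integrableZl m _ i1).
have i0' : mu.-integrable D (EFin \o (fun x => t ^+ 2 * (kern k l x * g x))).
  exact: (integrableZl m _ i0).
have i21 : mu.-integrable D (EFin \o (fun x => kern k.+2 l x * g x -
    2 * t * (kern k.+1 l x * g x))).
  by apply: eq_integrable (integrableB m i2 i1') => // x _; rewrite /= EFinB.
split.
  rewrite /mom -(RintegralZl _ m i1) -(RintegralZl _ m i0) -RintegralB// -RintegralD//.
  by apply: eq_Rintegral => x _; ring.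
apply: eq_integrable (integrableD m i21 i0') => // x _ /=.
by rewrite -EFinD; congr (_%:E); ring.
Qed.

Lemma convex_function_chord (f : R -> R) x y z : convex_function D f ->
  0 < x -> x < y -> y < z ->
  (z - x) * f y <= (z - y) * f x + (y - x) * f z.
Proof.
move=> cf x0 xy yz; have zx : 0 < z - x by lra.
have t0 : 0 <= (z - y) / (z - x) by rewrite divr_ge0; lra.
have t1 : (z - y) / (z - x) <= 1 by rewrite ler_pdivrMr//; lra.
have := cf (Itv01 t0 t1) x z.
rewrite !inE/= !in_itv/= !andbT => /(_ x0 (lt_trans x0 (lt_trans xy yz))).
rewrite [X in f X <= _](_ : _ = y); last first.
  rewrite -[LHS]/((z - y) / (z - x) * x + (1 - (z - y) / (z - x)) * z).
  by field; rewrite gt_eqF.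
rewrite -[leRHS]/((z - y) / (z - x) * f x + (1 - (z - y) / (z - x)) * f z).
move=> h; have := ler_wpM2l (ltW zx) h.
have -> // : (z - x) * ((z - y) / (z - x) * f x + (1 - (z - y) / (z - x)) * f z)
  = (z - y) * f x + (y - x) * f z.
by field; rewrite gt_eqF.
Qed.

(* With [al, be = t * (k + 2 -+ sqrt (k + 2))] the integrand of [mom_quad] is a
   positive multiple of [(x - al) * (x - be) * g x]. Log-convexity makes [g]
   lie above the exponential interpolating it at [al] and [be] outside
   [al, be] and below it inside, so replacing [g] by this exponential decreases
   the integral, and for an exponential the integral is a perfect square. *)
Lemma mom_log_convex g l t k : laplace_finite g -> (forall x, 0 < x -> 0 < g x) ->
  (forall x y, 0 < x -> x <= y -> g y <= g x) ->
  convex_function D (fun x => ln (g x)) -> 0 < l -> 0 < t ->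
  0 <= mom g l k.+2 - 2 * t * mom g l k.+1 + t ^+ 2 * mom g l k.
Proof.
move=> gl g0 gni cg l0 t0; pose q : R := k.+2%:R.
have q2 : 2 <= q by rewrite ler_nat.
pose r := Num.sqrt q; have r2 : r ^+ 2 = q by rewrite sqr_sqrtr//; lra.
have r0 : 0 < r by rewrite sqrtr_gt0; lra.
have rq : r < q by nra.
pose al := t * (q - r); pose be := t * (q + r).
have al0 : 0 < al by rewrite mulr_gt0//; lra.
have albe : al < be by rewrite ltr_pM2l//; lra.
have be0 : 0 < be by lra.
pose nu := (ln (g al) - ln (g be)) / (be - al).
pose c := expR (ln (g al) + nu * al).
(* Monotonicity of [g] makes the interpolating exponential nonincreasing, so its Laplace transform
   is finite at every positive point. *)
have nu0 : 0 <= nu.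
  rewrite divr_ge0 ?subr_ge0 ?(ltW albe)// ler_ln ?posrE ?g0//.
  by apply: gni => //; exact: ltW.
pose e x := c * expR (- (nu * x)).
have eE x : e x = expR (ln (g al) - nu * (x - al)).
  by rewrite /e /c -expRD; congr expR; ring.
have el : laplace_finite e by apply: laplace_finite_exp => //; exact: expR_ge0.
have nuE : nu * (be - al) = ln (g al) - ln (g be).
  by rewrite /nu divfK// subr_eq0 gt_eqF.
have sgn x : 0 < x -> (x - al) * (x - be) * e x <= (x - al) * (x - be) * g x.
  move=> x0; rewrite eE -[in leRHS](lnK (g0 x x0)); set L := _ - nu * _.
  have Lx : (be - al) * L = (be - al) * ln (g al) - (ln (g al) - ln (g be)) * (x - al).
    by rewrite -nuE /L; ring.
  have ba : 0 < be - al by lra.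
  have [xal|alx|->] := ltgtP x al; last by rewrite subrr !mul0r.
    have := convex_function_chord cg x0 xal albe => h.
    rewrite ler_wpM2l ?ler_expR; [by []|by nra|].
    by rewrite -(ler_pM2l ba) Lx; lra.
  have [xbe|bex|->] := ltgtP x be; last by rewrite subrr mulr0 !mul0r.
    have := convex_function_chord cg al0 alx xbe => h.
    rewrite ler_wnM2l ?ler_expR; [by []|by nra|].
    by rewrite -(ler_pM2l ba) Lx; lra.
  have := convex_function_chord cg al0 albe bex => h.
  rewrite ler_wpM2l ?ler_expR; [by []|by nra|].
  by rewrite -(ler_pM2l ba) Lx; lra.
have [-> ig] := mom_quad t k gl l0.
have [eq_e ie] := mom_quad t k el l0.
apply: (@le_trans _ _ (\int[mu]_(x in D) ((kern k.+2 l x - 2 * t * kern k.+1 l x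
     + t ^+ 2 * kern k l x) * e x))).
  rewrite -eq_e !mom_exp ?expR_ge0//; set m := l + nu.
  have m0 : 0 < m by rewrite ltr_wpDr.
  have -> : c / m ^+ k.+3 - 2 * t * (c / m ^+ k.+2) + t ^+ 2 * (c / m ^+ k.+1)
    = c / m ^+ k.+1 * (m^-1 - t) ^+ 2.
    by rewrite ![m ^+ _.+1]exprS; field; rewrite ?expf_neq0 ?gt_eqF.
  by rewrite mulr_ge0 ?sqr_ge0// divr_ge0 ?expR_ge0// exprn_ge0// ltW.
apply: le_Rintegral => // x /posP x0.
have -> : kern k.+2 l x - 2 * t * kern k.+1 l x + t ^+ 2 * kern k l x
  = kern k l x / ((q - 1) * q) * ((x - al) * (x - be)).
  rewrite /kern !factS !natrM -/q (_ : k.+1%:R = q - 1); last first.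
    by rewrite /q -[k.+2%:R]natr1 addrK.
  have -> : (x - al) * (x - be) = x ^+ 2 - 2 * t * q * x + t ^+ 2 * (q ^+ 2 - q).
    have -> : q ^+ 2 - q = q ^+ 2 - r ^+ 2 by rewrite r2.
    by rewrite /al /be; ring.
  rewrite !exprS; field.
  by rewrite pnatr_eq0 -lt0n fact_gt0 !gt_eqF//; lra.
have : 0 <= kern k l x / ((q - 1) * q).
  by rewrite divr_ge0 ?(kern_ge0 _ _ (ltW x0))// mulr_ge0//; lra.
move: (kern k l x / _) => K K0.
by rewrite -!(mulrA K) ler_wpM2l// sgn.
Qed.

End exponential_comparison.

(** * Gamma smoothing *)

Section smoothing.
Context {R : realType}.
Local Notation mu := (@lebesgue_measure R).
Local Notation D := (`]0%R, +oo[%classic : set (measurableTypeR R)).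
Implicit Types (g h W : R -> R) (c l t x y : R) (k n N : nat).

Lemma integrable_kern1 k l : 0 < l -> mu.-integrable D (EFin \o kern k l).
Proof.
move=> l0; have := integrable_kern k (laplace_finite_exp ler01 (lexx 0)) l0.
by apply: eq_integrable => // x _; rewrite /= mul0r oppr0 expR0 !mulr1.
Qed.

Lemma Rintegral_kern k l : 0 < l ->
  \int[mu]_(x in D) kern k l x = (l ^+ k.+1)^-1.
Proof. by move=> l0; rewrite /Rintegral integral_kern. Qed.

(* The law of large numbers for the Gamma distribution with density
   [l ^+ k.+1 * kern k l], of mean [k.+1 / l] and variance [k.+1 / l ^+ 2]. *)
Lemma gamma_smoothing_dist W x e K l k : laplace_finite W -> 0 < l ->
  (forall y, 0 < y -> `|W y - W x| <= e + K * (y - x) ^+ 2) ->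
  `|l ^+ k.+1 * mom W l k - W x| <=
  e + K * (k.+1%:R / l ^+ 2 + (k.+1%:R / l - x) ^+ 2).
Proof.
move=> Wl l0 WK; have m := @measurable_pos R; have ln0 : l != 0 by rewrite gt_eqF.
have lk0 : 0 < l ^+ k.+1 by rewrite exprn_gt0.
have i0 := integrable_kern1 k l0; have i1 := integrable_kern1 k.+1 l0.
have i2 := integrable_kern1 k.+2 l0; have iW := integrable_kern k Wl l0.
(* Coefficients of e + K (y - x)^2 after absorbing powers of y into the kernel: y [kern k] = (k + 1)
   [kern k.+1] and y^2 [kern k] = (k + 1) (k + 2) [kern k.+2]. *)
pose c0 := e + K * x ^+ 2; pose c1 := - 2 * K * x * k.+1%:R.
pose c2 := K * (k.+1%:R * k.+2%:R).
have j0 : mu.-integrable D (EFin \o (fun y => c0 * kern k l y)).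
  exact: (integrableZl m _ i0).
have j1 : mu.-integrable D (EFin \o (fun y => c1 * kern k.+1 l y)).
  exact: (integrableZl m _ i1).
have j2 : mu.-integrable D (EFin \o (fun y => c2 * kern k.+2 l y)).
  exact: (integrableZl m _ i2).
have j01 := integrableD m j0 j1; have j012 := integrableD m j01 j2.
have jW : mu.-integrable D (EFin \o (fun y => kern k l y * W x)).
  apply: eq_integrable (integrableZl m (W x) i0) => // y _.
  by rewrite /= -EFinM mulrC.
have -> : l ^+ k.+1 * mom W l k - W x =
    l ^+ k.+1 * \int[mu]_(y in D) (kern k l y * W y - kern k l y * W x).
  by rewrite RintegralB// RintegralZr// Rintegral_kern// mulrBr mulVKf// gt_eqF.
have -> : e + K * (k.+1%:R / l ^+ 2 + (k.+1%:R / l - x) ^+ 2) =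
    l ^+ k.+1 * \int[mu]_(y in D)
      (c0 * kern k l y + c1 * kern k.+1 l y + c2 * kern k.+2 l y).
  rewrite RintegralD// RintegralD// !RintegralZl// !Rintegral_kern//.
  rewrite /c0 /c1 /c2 !exprS -[k.+2%:R]natr1.
  by field; rewrite ln0 expf_neq0.
have jB := integrableB m iW jW.
rewrite normrM (gtr0_norm lk0) ler_pM2l//.
apply: (le_trans (le_normr_Rintegral m jB)).
apply: le_Rintegral => //; first exact: (integrable_norm jB).
move=> y /posP y0; rewrite -mulrBr normrM ger0_norm ?kern_ge0 ?(ltW y0)//.
apply: (le_trans (ler_wpM2l (kern_ge0 k l (ltW y0)) (WK y y0))).
rewrite le_eqVlt; apply/orP; left; apply/eqP.
rewrite /c0 /c1 /c2 /kern !factS !natrM !exprS.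
by field; rewrite nat1r -(natrD _ 2) !pnatr_eq0 -lt0n fact_gt0.
Qed.

(** Puts continuity at [x] into the form of Chebyshev's inequality, so that the second moment
    controls the smoothing error. Within distance r of [x] the term [e] suffices; at distance d >=
    r, linear growth gives 2 C (1 + x + d), where 1 + x <= (1 + x) d^2 / r^2 and d <= d^2 / r. *)
Lemma quadratic_modulus W x C : 0 < x -> {for x, continuous W} ->
  (forall y, 0 < y -> 0 <= W y <= C * (1 + y)) ->
  forall e, 0 < e -> exists2 K, 0 <= K &
    forall y, 0 < y -> `|W y - W x| <= e + K * (y - x) ^+ 2.
Proof.
move=> x0 cW WC e e0; have C0 : 0 <= C.
  have /andP[h1 h2] := WC x x0; have := le_trans h1 h2.
  by rewrite pmulr_lge0//; lra.
have /cvgrPdist_le/(_ e e0)[r /= r0 rW] := cW.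
pose K := 2 * C * ((1 + x) / r ^+ 2 + r^-1).
have K0 : 0 <= K.
  rewrite mulr_ge0 ?mulr_ge0// addr_ge0 ?invr_ge0 ?(ltW r0)//.
  by rewrite divr_ge0 ?exprn_ge0 ?(ltW r0)//; lra.
exists K => // y y0; have [yr|yr] := ltP `|x - y| r.
  by rewrite distrC (le_trans (rW y yr))// lerDl mulr_ge0// sqr_ge0.
set d := `|x - y| in yr.
have d2 : (y - x) ^+ 2 = d ^+ 2 by rewrite /d real_normK ?num_real// -sqrrN opprB.
have h1 := WC x x0; have h2 := WC y y0.
have yd : y <= x + d by rewrite /d; have := ler_norm (y - x); rewrite distrC; lra.
have W1 : `|W y - W x| <= 2 * C * (1 + x + d).
  have d0 : 0 <= d by rewrite /d.
  rewrite ler_norml; apply/andP; split; nra.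
apply: (le_trans W1); rewrite d2 -[leLHS]add0r lerD ?(ltW e0)// /K -[leRHS]mulrA.
rewrite ler_wpM2l ?mulr_ge0// mulrDl lerD//.
  rewrite mulrAC -[leLHS]mulr1 -mulrA ler_wpM2l//; first lra.
  by rewrite ler_pdivlMr ?exprn_gt0// mul1r lerXn2r// nnegrE ltW// (lt_le_trans r0).
by rewrite mulrC ler_pdivlMr// expr2 ler_wpM2l// ltW// (lt_le_trans r0).
Qed.

Lemma cvg_truncn x : 0 <= x ->
  (Num.truncn (n%:R * x))%:R / n%:R @[n --> \oo] --> x.
Proof.
move=> x0; apply/cvgrPdist_le => e e0; near=> n.
have n0 : 0 < n%:R :> R by rewrite ltr0n; near: n; exists 1%N.
have ne : n%:R^-1 <= e.
  rewrite -[e]invrK lef_pV2 ?posrE ?invr_gt0//.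
  near: n. exact: (@nbhs_infty_ger R _).
have nx : 0 <= n%:R * x by rewrite mulr_ge0// ltW.
have /andP[h1 h2] := truncn_itv nx; rewrite -natr1 in h2.
rewrite ger0_norm; last first.
  by rewrite subr_ge0 ler_pdivrMr// [x * _]mulrC.
rewrite (le_trans _ ne)// lerBlDr -[X in X + _]mul1r -mulrDl addrC ler_pdivlMr//.
rewrite [x * _]mulrC.
exact: ltW.
Unshelve. all: by end_near. Qed.

Lemma gamma_smoothing W x C : laplace_finite W -> 0 < x ->
  {for x, continuous W} -> (forall y, 0 < y -> 0 <= W y <= C * (1 + y)) ->
  n%:R ^+ (Num.truncn (n%:R * x)).+1 * mom W n%:R (Num.truncn (n%:R * x))
    @[n --> \oo] --> W x.
Proof.
move=> Wl x0 cW WC; apply/cvgrPdist_le => e e0.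
have e20 : 0 < e / 2 by rewrite divr_gt0.
have [K K0 WK] := quadratic_modulus x0 cW WC e20.
near=> n; set k := Num.truncn _.
have n1 : 1 <= n%:R :> R by rewrite (ler_nat _ 1); near: n; exists 1%N.
have n0 : 0 < n%:R :> R by lra.
have nx : 0 <= n%:R * x by rewrite mulr_ge0// ltW.
have /andP[h1 h2] := truncn_itv nx; rewrite -/k -natr1 in h1 h2.
rewrite distrC (le_trans (gamma_smoothing_dist k Wl n0 WK))//.
rewrite [leRHS](splitr e) lerD2l.
have ne : K * (x + 2) / (e / 2) <= n%:R.
  near: n. exact: (@nbhs_infty_ger R _).
rewrite ler_pdivrMr// in ne; set m := n%:R in n1 n0 h1 h2 ne *.
have m2 : 0 < m ^+ 2 by rewrite exprn_gt0.
have -> : k.+1%:R / m ^+ 2 + (k.+1%:R / m - x) ^+ 2 =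
    (k%:R + 1 + (k%:R + 1 - m * x) ^+ 2) / m ^+ 2.
  by rewrite -natr1; field; rewrite gt_eqF.
rewrite mulrA ler_pdivrMr//; set q := k%:R in h1 h2 *.
(* The variance contributes q + 1 <= m x + 1 and the squared bias at most 1, since q = floor(m x);
   then 2 <= 2 m. Mean square distance is therefore at most (x + 2) / m. *)
have hq : q + 1 + (q + 1 - m * x) ^+ 2 <= (x + 2) * m.
  have : (q + 1 - m * x) ^+ 2 <= 1 by nra.
  nra.
apply: (le_trans (ler_wpM2l K0 hq)); rewrite expr2 !mulrA ler_wpM2r ?(ltW n0)//.
by rewrite [e / 2 * m]mulrC.
Unshelve. all: by end_near. Qed.

End smoothing.

(** * Concavity from the Laplace identity *)

Section concave_inverse.
Context {R : realType}.
Local Notation mu := (@lebesgue_measure R).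
Local Notation D := (`]0%R, +oo[%classic : set (measurableTypeR R)).
Implicit Types (g h W : R -> R) (c l t x y : R) (k n N : nat).

Lemma momE g l k : laplace_finite g -> 0 < l ->
  (mom g l k)%:E = (\int[mu]_(x in D) (kern k l x * g x)%:E)%E.
Proof.
move=> gl l0; rewrite fineK//; apply: integrable_fin_num => //.
exact: integrable_kern.
Qed.

Lemma integral_kern0_tail l x : 0 < l -> 0 <= x ->
  (\int[mu]_(y in `[x, +oo[) (kern 0 l y)%:E = (expR (- (l * x)) / l)%:E)%E.
Proof.
move=> l0 x0; have dP y := is_derive_kern_primitive 0 y l0.
rewrite (@ge0_continuous_FTC2y _ _ (kern_primitive l 0) _ 0).
- by rewrite /= kern0 -EFinB sub0r mulNr opprK.
- by move=> y xy; apply: kern_ge0; apply: le_trans xy.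
- apply: continuous_subspaceT => y.
  apply/differentiable_continuous/derivable1_diffP.
  by have [] := is_derive_kern0 l y.
- exact: kern_primitive_cvgy.
- by move=> y _; have [] := dP y.
- apply: cvg_at_right_filter; apply/differentiable_continuous/derivable1_diffP.
  by have [] := dP x.
- by move=> y _; rewrite derive1E; have /@derive_val := dP y.
Qed.

(** Only the part of the integral beyond [x] is kept, where [W] is at least [W x]. This is how a
    bound on the transform becomes a pointwise bound. *)
Lemma mom0_ge W l x : laplace_finite W ->
  (forall y z, 0 < y -> y <= z -> W y <= W z) -> 0 < l -> 0 < x ->
  W x * (expR (- (l * x)) / l) <= mom W l 0.
Proof.
move=> Wl Wnd l0 x0; have [mW W0 _] := Wl.
have sub : `[x, +oo[%classic `<=` D.
  by move=> y; rewrite /= !in_itv/= !andbT; exact: lt_le_trans.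
have mx : measurable (`[x, +oo[%classic : set (measurableTypeR R)).
  exact: measurable_itv.
have mk : measurable_fun `[x, +oo[%classic (kern 0 l).
  by apply: measurable_funS (@measurable_kern R 0 l) => //; exact: measurable_itv.
rewrite -lee_fin momE// EFinM -integral_kern0_tail ?(ltW x0)//.
have kge0 y : `[x, +oo[%classic y -> 0 <= kern 0 l y.
  by move=> /sub/posP y0; apply: kern_ge0; exact: ltW.
have Wge0 y : `[x, +oo[%classic y -> 0 <= W y by move=> /sub/posP; exact: W0.
rewrite -ge0_integralZl_EFin ?W0//; last exact/measurable_EFinP.
apply: (@le_trans _ _ (\int[mu]_(y in `[x, +oo[) (kern 0 l y * W y)%:E)%E).
  apply: ge0_le_integral => //.
  - by move=> y xy; apply: mule_ge0; rewrite lee_fin ?kge0// W0.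
  - by apply/measurable_EFinP; apply: measurable_funM.
  - apply/measurable_EFinP; apply: measurable_funM => //.
    by apply: measurable_funS mW => //; exact: measurable_itv.
  move=> y xy; rewrite -EFinM lee_fin mulrC ler_wpM2l ?kge0// Wnd//.
  by move: xy; rewrite /= in_itv/= andbT.
apply: ge0_subset_integral => //.
  by apply/measurable_EFinP; apply: measurable_funM => //; exact: measurable_kern.
by move=> y /posP y0; rewrite lee_fin mulr_ge0 ?W0 ?kern_ge0// ltW.
Qed.

(** Monotonicity gives the minorant h(y) >= h(M) (1 - y / M): beyond [M] the right side is negative.
    Its moment is explicit, and with [M] twice the mean (k + 1) / l of the Gamma law exactly half of
    h(M) / l^(k+1) remains. *)
Lemma mom_gt0 h l k : laplace_finite h -> (forall x, 0 < x -> 0 < h x) ->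
  (forall x y, 0 < x -> x <= y -> h y <= h x) -> 0 < l -> 0 < mom h l k.
Proof.
move=> hl h0 hni l0; pose M := 2 * k.+1%:R / l.
have M0 : 0 < M by rewrite divr_gt0// mulr_gt0// ltr0n.
have i0 := integrable_kern1 k l0; have i1 := integrable_kern1 k.+1 l0.
have m := @measurable_pos R; pose c := - (h M * (k.+1%:R / M)).
have j0 : mu.-integrable D (EFin \o (fun y => h M * kern k l y)).
  exact: (integrableZl m _ i0).
have j1 : mu.-integrable D (EFin \o (fun y => c * kern k.+1 l y)).
  exact: (integrableZl m _ i1).
have j01 := integrableD m j0 j1.
apply: (@lt_le_trans _ _ (\int[mu]_(x in D) (h M * kern k l x + c * kern k.+1 l x))).
  rewrite RintegralD// !RintegralZl// !Rintegral_kern//.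
  have -> : h M / l ^+ k.+1 + c / l ^+ k.+2 = h M / l ^+ k.+1 / 2.
    rewrite /c /M !exprS; field.
    by rewrite nat1r pnatr_eq0/= expf_neq0 ?gt_eqF.
  by rewrite !divr_gt0 ?h0// exprn_gt0.
apply: le_Rintegral => //; first exact: integrable_kern.
move=> x /posP x0; have kx := kern_ge0 k l (ltW x0).
have -> : h M * kern k l x + c * kern k.+1 l x = kern k l x * (h M * (1 - x / M)).
  rewrite /c /kern factS natrM exprS; field.
  by rewrite nat1r !pnatr_eq0 -lt0n fact_gt0 gt_eqF.
rewrite ler_wpM2l//; have [xM|Mx] := leP x M.
  apply: le_trans (hni _ _ x0 xM).
  by rewrite ler_piMr ?(ltW (h0 _ M0))// gerBl divr_ge0// ltW.
apply: (@le_trans _ _ 0); last exact/ltW/h0.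
by rewrite mulr_ge0_le0 ?(ltW (h0 _ M0))// subr_le0 ler_pdivlMr// mul1r ltW.
Qed.

Lemma mom_antitone h l m k : laplace_finite h -> 0 < l -> l <= m ->
  mom h m k <= mom h l k.
Proof.
move=> hl l0 lm; have [_ h0 _] := hl; have m0 := lt_le_trans l0 lm.
apply: le_Rintegral => //; [exact: integrable_kern|exact: integrable_kern|].
move=> x /posP x0; rewrite ler_wpM2r ?h0//.
rewrite ler_wpM2l ?divr_ge0 ?exprn_ge0 ?(ltW x0)//.
by rewrite ler_expR lerN2 ler_wpM2r// ltW.
Qed.

Section laplace_identity.
Variables (h W : R -> R) (delta kappa : R).
Hypotheses (delta0 : 0 <= delta) (kappa0 : 0 <= kappa).
Hypotheses (hl : laplace_finite h) (h0 : forall x, 0 < x -> 0 < h x).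
Hypothesis h_ni : forall x y, 0 < x -> x <= y -> h y <= h x.
Hypothesis h_lc : convex_function D (fun x => ln (h x)).
Hypotheses (Wl : laplace_finite W).
Hypothesis W_nd : forall x y, 0 < x -> x <= y -> W x <= W y.
Hypothesis W_cont : forall x, 0 < x -> {for x, continuous W}.
Hypothesis hW : forall l, 0 < l ->
  l ^+ 2 * (delta + kappa / l + mom h l 0) * mom W l 0 = 1.

Let F l := delta + kappa / l + mom h l 0.

Let F_gt0 l : 0 < l -> 0 < F l.
Proof.
move=> l0; rewrite ltr_wpDl ?mom_gt0// addr_ge0// divr_ge0//.
exact: ltW.
Qed.

(** Take l = 1 / x with x >= 1: [mom0_ge] gives x W(x) / e <= x^2 / F(1 / x), and F is
    nonincreasing, so W(x) <= (e / F(1)) x. Below 1 monotonicity of [W] is enough. *)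
Lemma inverse_linear_growth :
  exists C, forall x, 0 < x -> 0 <= W x <= C * (1 + x).
Proof.
have [_ W0 _] := Wl; pose c := expR 1 / F 1.
have c0 : 0 < c by rewrite divr_gt0 ?expR_gt0 ?F_gt0.
have bnd x : 1 <= x -> W x <= c * x.
  move=> x1; have x0 : 0 < x by lra.
  have xV : 0 < x^-1 by rewrite invr_gt0.
  have xV1 : x^-1 <= 1 by rewrite invf_le1.
  have FV : F 1 <= F x^-1.
    rewrite /F lerD ?mom_antitone// lerD2l invrK divr1.
    by rewrite ler_peMr.
  have := mom0_ge Wl W_nd xV x0; rewrite mulVf ?gt_eqF// invrK => h1.
  have := hW xV; rewrite -/(F _) => e.
  have m0 := mom_ge0 x^-1 0 Wl.
  have : mom W x^-1 0 * F 1 <= x ^+ 2.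
    have -> : x ^+ 2 = F x^-1 * mom W x^-1 0.
      by rewrite -[LHS]mulr1 -e; field; rewrite gt_eqF.
    by rewrite mulrC ler_wpM2r.
  rewrite -ler_pdivlMr ?F_gt0// => h2.
  have := le_trans h1 h2; rewrite expRN mulrA => h3.
  have h4 := ler_wpM2r (expR_ge0 1) h3.
  have -> : W x = W x / expR 1 * x * expR 1 / x.
    by field; rewrite !gt_eqF ?expR_gt0.
  rewrite ler_pdivrMr// (le_trans h4)// le_eqVlt; apply/orP; left; apply/eqP.
  by rewrite /c; ring.
exists (W 1 + c) => x x0; rewrite W0//=; have W1 := W0 1 ltr01.
have [x1|x1] := leP x 1.
  by apply: (le_trans (W_nd x0 x1)); nra.
by apply: (le_trans (bnd x (ltW x1))); nra.
Qed.

Let b l k := (if k == 0%N then delta else 0) + kappa / l ^+ k.+1 + mom h l k.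

Let b_gt0 l k : 0 < l -> 0 < b l k.
Proof.
move=> l0; rewrite ltr_wpDl ?mom_gt0// addr_ge0//; first by case: ifP.
by rewrite divr_ge0// exprn_ge0// ltW.
Qed.

(** At t = b_(k+1) / b_k the quadratic form equals (b_k b_(k+2) - b_(k+1)^2) / b_k. The [kappa] part
    is geometric and yields a perfect square; [delta] meets only the t^2 term, and only for k =
    0. *)
Let b_log_convex l k : 0 < l -> b l k.+1 ^+ 2 <= b l k * b l k.+2.
Proof.
move=> l0; have bk := b_gt0 k l0; pose t := b l k.+1 / b l k.
have t0 : 0 < t by rewrite divr_gt0 ?b_gt0.
have := mom_log_convex k hl h0 h_ni h_lc l0 t0 => hm.
have hk : 0 <= kappa / l ^+ k.+3 - 2 * t * (kappa / l ^+ k.+2)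
    + t ^+ 2 * (kappa / l ^+ k.+1).
  have -> : kappa / l ^+ k.+3 - 2 * t * (kappa / l ^+ k.+2)
    + t ^+ 2 * (kappa / l ^+ k.+1) = kappa / l ^+ k.+1 * (l^-1 - t) ^+ 2.
    by rewrite !exprS; field; rewrite expf_neq0 ?gt_eqF.
  by rewrite mulr_ge0 ?sqr_ge0// divr_ge0// exprn_ge0// ltW.
have hd : 0 <= t ^+ 2 * (if k == 0%N then delta else 0).
  by rewrite mulr_ge0 ?sqr_ge0//; case: ifP.
have : 0 <= b l k.+2 - 2 * t * b l k.+1 + t ^+ 2 * b l k by rewrite /b /=; lra.
have -> : b l k.+2 - 2 * t * b l k.+1 + t ^+ 2 * b l k =
    (b l k * b l k.+2 - b l k.+1 ^+ 2) / b l k.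
  by rewrite /t; field; rewrite gt_eqF.
by rewrite pmulr_lge0 ?invr_gt0// subr_ge0.
Qed.

Let moments_concave l k : 0 < l ->
  l ^+ 2 * mom W l k.+2 - 2 * l * mom W l k.+1 + mom W l k <= 0.
Proof.
(* The coefficient wanted has index [k.+2], the last one below the truncation order. *)
move=> l0; pose N := k.+3.
pose a : {poly R} := \poly_(j < N) b l j.
pose w : {poly R} := \poly_(j < N) mom W l j.
pose c : {poly R} := (l%:P - 'X) ^+ 2.
have l20 : 0 < l / 2 by rewrite divr_gt0.
(* The constant [kappa], written as an exponential of rate 0, so that [kappa / (l - s)] is expanded
   by the same lemma as the other transforms. *)
pose one x := kappa * expR (- (0 * x)).
have onel : laplace_finite one by exact: laplace_finite_exp.
have [C1 H1] := mom_expansion N hl l0.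
have [C2 H2] := mom_expansion N onel l0.
have [C3 H3] := mom_expansion N Wl l0.
pose C := `|C1| + `|C2| + `|C3|.
have CE : C1 + C2 <= C /\ C3 <= C.
  rewrite /C; have := ler_norm C1; have := ler_norm C2; have := ler_norm C3.
  by have := normr_ge0 C1; have := normr_ge0 C2; have := normr_ge0 C3; split; lra.
have key := @coef_inverse_expansion R N (l / 2) C
  (fun s => F (l - s)) (fun s => mom W (l - s) 0) a w c l20.
have cw j : (c * w)`_j.+2 =
    l ^+ 2 * w`_j.+2 - 2 * l * w`_j.+1 + w`_j.
  rewrite /c sqrrB.
  have -> : (l%:P ^+ 2 - l%:P * 'X *+ 2 + 'X ^+ 2) * w =
    (l ^+ 2)%:P * w - (2 * l)%:P * (w * 'X) + w * 'X^2 :> {poly R}.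
    by rewrite rmorphXn rmorphM/= polyC_natr; ring.
  by rewrite coefD coefB !coefCM coefMX coefMXn/= subn2.
have cw0 : (c * w)`_0 = l ^+ 2 * w`_0.
  by rewrite coef0M /c expr2 coef0M coefB coefC coefX/= subr0 -expr2.
have wE j : (j <= k.+2)%N -> w`_j = mom W l j.
  by move=> jN; rewrite coef_poly /N ltnS jN.
have -> : l ^+ 2 * mom W l k.+2 - 2 * l * mom W l k.+1 + mom W l k = (c * w)`_k.+2.
  by rewrite cw !wE// ?leqnSn// leqW.
(* Instance [k.+1] bounds the coefficient of index [k.+2], which is never the nonnegative leading
   one. *)
apply: (@kaluza R k.+2 (b l) (fun j => (c * w)`_j) _ _ _ _ k.+1) => //.
- by move=> j; exact: b_gt0.
- by move=> j; exact: b_log_convex.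
- by rewrite cw0 wE// mulr_ge0 ?sqr_ge0// mom_ge0.
(* Replacing [b l] by its truncation [a] does not change this convolution, as [j.+1 <= k.+2 < N]. *)
move=> j jk; transitivity (a * (c * w))`_j.+1; last first.
  rewrite key//; move=> s s0 sl; have sN0 : 0 <= s ^+ N by rewrite exprn_ge0// ltW.
  - have -> : F (l - s) - a.[s] =
      (mom h (l - s) 0 - \sum_(i < N) mom h l i * s ^+ i) +
      (mom one (l - s) 0 - \sum_(i < N) mom one l i * s ^+ i).
      have dE : \sum_(i < N) (if i == 0%N :> nat then delta else 0) * s ^+ i = delta.
        by rewrite big_ord_recl/= mulr1 big1 ?addr0// => i _; rewrite mul0r.
      have -> : a.[s] = delta + \sum_(i < N) mom one l i * s ^+ i
          + \sum_(i < N) mom h l i * s ^+ i.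
        rewrite horner_poly -{1}dE -!big_split/=; apply: eq_bigr => i _.
        by rewrite /b mom_exp// addr0 !mulrDl.
      rewrite [mom one (l - s) 0]mom_exp//; last by lra.
      by rewrite addr0 expr1 /F; ring.
    apply: (le_trans (ler_normD _ _)).
    apply: (le_trans (lerD (H1 s s0 sl) (H2 s s0 sl))).
    by rewrite -mulrDl ler_wpM2r//; case: CE.
  - rewrite horner_poly; apply: (le_trans (H3 s s0 sl)).
    by rewrite ler_wpM2r//; case: CE.
  - have ls : 0 < l - s by lra.
    by rewrite !hornerE; exact: hW.
rewrite (coefMr a); apply: eq_bigr => i _.
by rewrite coef_poly (leq_ltn_trans (leq_subr _ _)).
Qed.

(** For each n the three-point inequality holds for [u n] at the indices floor(n x), floor(n y),
    floor(n z). After division by n both the weights and the values converge. *)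
Lemma concave_chord x y z : 0 < x -> x <= y -> y <= z ->
  (z - y) * W x + (y - x) * W z <= (z - x) * W y.
Proof.
move=> x0 xy yz; have [C WC] := inverse_linear_growth.
have y0 := lt_le_trans x0 xy; have z0 := lt_le_trans y0 yz.
pose i n t := Num.truncn (n%:R * t : R).
pose u n k := n%:R ^+ k.+1 * mom W n%:R k.
have ui t : 0 < t -> u n (i n t) @[n --> \oo] --> W t.
  by move=> t0; apply: gamma_smoothing (W_cont t0) WC.
have ii t : 0 < t -> (i n t)%:R / n%:R @[n --> \oo] --> t.
  by move=> t0; apply: cvg_truncn; exact: ltW.
have cl : ((i n z)%:R / n%:R - (i n y)%:R / n%:R) * u n (i n x)
    + ((i n y)%:R / n%:R - (i n x)%:R / n%:R) * u n (i n z)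
    @[n --> \oo] --> (z - y) * W x + (y - x) * W z.
  apply: cvgD; apply: cvgM; [apply: cvgB|exact: ui|apply: cvgB|exact: ui];
    exact: ii.
have cr : ((i n z)%:R / n%:R - (i n x)%:R / n%:R) * u n (i n y)
    @[n --> \oo] --> (z - x) * W y.
  by apply: cvgM; [apply: cvgB; exact: ii|exact: ui].
apply: (ler_cvg_to cl cr); near=> n.
have n0 : 0 < n%:R :> R by rewrite ltr0n; near: n; exists 1%N.
(* The normalisation n^(k+1) turns the weights n^2, 2 n, 1 of [moments_concave] into those of a
   second difference. *)
have uc k : u n k.+2 - 2 * u n k.+1 + u n k <= 0.
  have -> : u n k.+2 - 2 * u n k.+1 + u n k = n%:R ^+ k.+1 *
    (n%:R ^+ 2 * mom W n%:R k.+2 - 2 * n%:R * mom W n%:R k.+1 + mom W n%:R k).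
    by rewrite /u !exprS; ring.
  by rewrite mulr_ge0_le0 ?exprn_ge0 ?(ltW n0) ?moments_concave.
have ixy : (i n x <= i n y)%N by rewrite le_truncn// ler_wpM2l// ltW.
have iyz : (i n y <= i n z)%N by rewrite le_truncn// ler_wpM2l// ltW.
have := concave_seq uc ixy iyz.
rewrite -!mulrBl ![_ * n%:R^-1 * _]mulrAC -mulrDl ler_pM2r// invr_gt0//.
Unshelve. all: by end_near. Qed.

Lemma inverse_concave : concave_on D W.
Proof.
move=> t x y; rewrite !inE/= !in_itv/= !andbT.
wlog xy : t x y / x <= y => [hwlog|] x0 y0.
  have [xy|yx] := leP x y; first exact: hwlog.
  by rewrite convC [in leRHS]convC; apply: hwlog => //; exact: ltW.
set s := t%:num; pose z := s * x + (1 - s) * y.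
have s0 : 0 <= s by rewrite /s.
have s1 : s <= 1 by rewrite /s.
have xz : x <= z by rewrite /z; nra.
have zy : z <= y by rewrite /z; nra.
rewrite -[X in - W X <= _]/z -[leRHS]/(s * - W x + (1 - s) * - W y).
have := concave_chord x0 xz zy.
have -> : y - z = s * (y - x) by rewrite /z; ring.
have -> : z - x = (1 - s) * (y - x) by rewrite /z; ring.
move: xy; rewrite le_eqVlt => /predU1P[xy|xy].
  move=> _; rewrite /z xy (_ : s * y + (1 - s) * y = y); first by lra.
  by ring.
have yx : 0 < y - x by lra.
have -> : s * (y - x) * W x + (1 - s) * (y - x) * W y =
  (y - x) * (s * W x + (1 - s) * W y) by ring.
by rewrite ler_pM2l//; lra.
Qed.

End laplace_identity.
End concave_inverse.

(** * Tails of the Levy measure *)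

Section levy_tail.
Context {R : realType}.
Local Notation T := (measurableTypeR R).
Local Notation mu := (@lebesgue_measure R).
Local Notation D := (`]0%R, +oo[%classic : set (measurableTypeR R)).
Implicit Types (Pi : {measure set T -> \bar R}) (pi : R -> R) (x y z l : R).
Local Open Scope ereal_scope.

(** [Pi] is a bare measure, whereas Tonelli's theorem wants a sigma-finite structure; it is packed
    from the proof [sf], and the conclusions are carried back along the equality of the two
    measures. *)
Lemma sigma_finite_tonelli Pi (f : T * T -> \bar R) : sigma_finite setT Pi ->
  measurable_fun setT f -> (forall p, 0 <= f p) ->
  \int[mu]_z \int[Pi]_x f (z, x) = \int[Pi]_x \int[mu]_z f (z, x) /\
  measurable_fun setT (fun z => \int[Pi]_x f (z, x)).
Proof.
move=> sf mf f0.
pose H1 := isSFinite.Build _ _ _ _ (sfinite_measure_sigma_finite sf).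
pose H2 := isSigmaFinite.Build _ _ _ _ sf.
pose PiS := HB.pack_for (SigmaFiniteMeasure.type T R)
  (Measure.sort Pi) H1 H2.
have PiE : Pi = PiS by exact: eq_measure.
rewrite PiE; split; first exact: (fubini_tonelli f).
exact: (measurable_fun_fubini_tonelli_F f).
Qed.

(** Markov's inequality for min(1, x^2), which is at least min(1, z^2) > 0 beyond [z]. *)
Lemma levy_tail_lty Pi z : levy_measure Pi -> (0 < z)%R -> Pi `]z, +oo[%classic < +oo.
Proof.
move=> [_ Pi_int] z0; pose c := Num.min 1%R (z ^+ 2)%R.
have c0 : (0 < c)%R by rewrite lt_min ltr01 exprn_gt0.
have mmin : measurable_fun D (fun x => (Num.min 1 (x ^+ 2))%:E).
  apply/measurable_EFinP; apply: measurable_minr => //; exact: measurable_funX.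
have sub : `]z, +oo[%classic `<=` D.
  by move=> x; rewrite /= !in_itv/= !andbT; exact: lt_trans.
have mz : measurable (`]z, +oo[%classic : set T) by exact: measurable_itv.
have : c%:E * Pi `]z, +oo[%classic < +oo.
  apply: le_lt_trans Pi_int; rewrite -integral_cst//.
  apply: (@le_trans _ _ (\int[Pi]_(x in `]z, +oo[) (Num.min 1 (x ^+ 2))%:E)).
    apply: ge0_le_integral => //.
    - by move=> x _; rewrite lee_fin ltW.
    - exact: measurable_funS mmin.
    move=> x; rewrite /= in_itv/= andbT => zx.
    have z2 : (z ^+ 2 <= x ^+ 2)%R.
      by rewrite ler_sqr ?nnegrE ltW// (lt_trans z0).
    by rewrite lee_fin /c le_min !ge_min lexx z2 orbT.
  apply: ge0_subset_integral => //.
  by move=> x _; rewrite lee_fin le_min ler01 sqr_ge0.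
move: (Pi _) (measure_ge0 Pi `]z, +oo[%classic) => [r _ _|_|//].
  by rewrite ltry.
by rewrite gt0_muley.
Qed.

Lemma levy_sigma_finite Pi : levy_measure Pi -> sigma_finite setT Pi.
Proof.
move=> lPi; have [Pi0 _] := lPi.
(* Mass can be infinite only near 0+. The null half-line is added because the sets must cover all of
   R. *)
exists (fun n => `]-oo, 0%R]%classic `|` `](n.+1%:R^-1)%R, +oo[%classic).
  apply/esym; rewrite -subTset => x _; have [x0|x0] := leP x 0%R.
    by exists 0%N => //; left; rewrite /= in_itv.
  exists (Num.truncn x^-1) => //; right; rewrite /= in_itv/= andbT.
  have xV : (0 <= x^-1)%R by rewrite invr_ge0 ltW.
  have /andP[_ h] := truncn_itv xV.
  by rewrite invf_plt ?posrE.
move=> n; have n0 : (0 < n.+1%:R^-1 :> R)%R by rewrite invr_gt0.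
have m1 : measurable (`]-oo, 0%R]%classic : set T) by exact: measurable_itv.
have m2 : measurable (`](n.+1%:R^-1)%R, +oo[%classic : set T) by exact: measurable_itv.
split; first exact: measurableU.
apply: (le_lt_trans (measureU2 Pi m1 m2)).
apply: lte_add_pinfty; last exact: levy_tail_lty.
exact: (eq_ind_r (fun a => a < +oo) (ltry 0%R) Pi0).
Qed.

Lemma UpsilonE Pi pi z : levy_measure Pi -> positive_density Pi pi ->
  (0 < z)%R -> (Upsilon pi z)%:E = Pi `]z, +oo[%classic.
Proof.
move=> lPi [_ _ piE] z0; rewrite /Upsilon /Rintegral -piE.
- by rewrite fineK// ge0_fin_numE// levy_tail_lty.
- exact: measurable_itv.
- by move=> x; rewrite /= !in_itv/= !andbT; exact: lt_trans.
Qed.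

Lemma integral_pos_support Pi (f : T -> \bar R) :
  (forall x, (x <= 0)%R -> f x = 0) -> \int[Pi]_x f x = \int[Pi]_(x in D) f x.
Proof.
move=> f0; rewrite [RHS]integral_mkcond; apply: eq_integral => x _.
rewrite patchE; case: ifPn => // xD; apply: f0; rewrite leNgt.
by apply: contra xD; rewrite inE/= in_itv/= andbT.
Qed.

(* The value 0 of a divergent real-valued integral is excluded by positivity. *)
Lemma Upsilon_barE Pi pi z : levy_measure Pi -> positive_density Pi pi ->
  (0 < z)%R -> (0 < Upsilon_bar pi z)%R ->
  (Upsilon_bar pi z)%:E = \int[Pi]_(x in D) (Num.max 0 (x - z))%:E.
Proof.
move=> lPi ppi z0; rewrite /Upsilon_bar /Rintegral => U0.
set I := \int[mu]_(x in _) _ in U0 *.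
have -> : (fine I)%:E = I.
  by move: I U0 => [r| |] //=; rewrite ltxx.
(* Layer-cake formula: for the indicator of z < w < x, integrating in x first gives the tail Pi(w,
   oo), and in w first the length of ]z, x[. *)
pose f (p : T * T) : \bar R :=
  (if (z < p.1) && (p.1 < p.2) then 1 else 0)%R%:E.
have f0 p : 0 <= f p by rewrite lee_fin; case: ifP.
have mf : measurable_fun setT f.
  apply/measurable_EFinP; apply: measurable_fun_ifT => //.
  by apply: measurable_and; apply: measurable_fun_ltr.
have [tE _] := sigma_finite_tonelli (levy_sigma_finite lPi) mf f0.
have -> : I = \int[mu]_w \int[Pi]_x f (w, x).
  rewrite /I integral_mkcond; apply: eq_integral => w _; rewrite patchE.
  have [wz|wz] := leP w z.
    rewrite memNset/= ?in_itv/= ?ltNge ?wz// integral0_eq// => x _.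
    by rewrite /f/= ltNge wz.
  have w0 := lt_trans z0 wz.
  rewrite mem_set/= ?in_itv/= ?wz// (UpsilonE lPi ppi w0).
  have mw : measurable (`]w, +oo[%classic : set T) by exact: measurable_itv.
  rewrite -(setIT `]w, +oo[%classic) -integral_indic//.
  apply: eq_integral => x _; rewrite /f/= wz/= indicE; congr (_%:E).
  by rewrite mem_setE/= in_itv/= andbT; case: ifP.
rewrite tE integral_pos_support//; last first.
  move=> x x0; apply: integral0_eq => w _; rewrite /f/=.
  by have [zw|//] := ltP z w; rewrite ltNge (le_trans x0)// ltW// (lt_trans z0).
apply: eq_integral => x _.
transitivity (mu `]z, x[%classic).
  have mzx : measurable (`]z, x[%classic : set T) by exact: measurable_itv.
  rewrite -(setIT `]z, x[%classic) -integral_indic//.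
  apply: eq_integral => w _; rewrite /f/= indicE; congr (_%:E).
  by rewrite mem_setE/= in_itv/=; case: ifP.
rewrite lebesgue_measure_itv/= lte_fin.
have [zx|xz] := ltP z x; last by congr (_%:E); apply/esym/max_idPl; rewrite subr_le0.
by rewrite -EFinB; congr (_%:E); apply/esym/max_idPr; rewrite subr_ge0 ltW.
Qed.

End levy_tail.

(** * The compensated exponential *)

Section compensated_exponential.
Context {R : realType}.
Local Notation T := (measurableTypeR R).
Local Notation mu := (@lebesgue_measure R).
Local Notation D := (`]0%R, +oo[%classic : set (measurableTypeR R)).
Implicit Types (Pi : {measure set T -> \bar R}) (pi : R -> R) (x y z l : R).

(** The jump integrand of psi with the compensation extended from jumps below 1 to all jumps, which
    makes it nonnegative. *)
Definition cexp l x : R := expR (- (l * x)) - 1 + l * x.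

Lemma cexp_ge0 l x : 0 <= cexp l x.
Proof. by rewrite /cexp; have := expR_ge1Dx (- (l * x)); lra. Qed.

Lemma cexp_le_lin l x : 0 <= l * x -> cexp l x <= l * x.
Proof.
move=> lx; have : expR (- (l * x)) <= 1 by rewrite expR_le1 oppr_le0.
by rewrite /cexp; lra.
Qed.

Lemma cexp_le_sqr l x : 0 <= l * x -> cexp l x <= (l * x) ^+ 2.
Proof.
rewrite /cexp; move: (l * x) => y y0.
have h := expR_ge1Dx y; have e0 := expR_gt0 (- y).
have e : expR (- y) * expR y = 1 by rewrite mulrC expRxMexpNx_1.
have h1 : expR (- y) * (1 + y) <= 1 by rewrite -[leRHS]e ler_wpM2l // ltW.
(* The multiplier is the cofactor in (1 + y) (1 - y + y^2) = 1 + y^3, so that e^(-y) <= e^(-y) (1 +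
   y^3) <= 1 - y + y^2. *)
have h2 : expR (- y) * (1 + y) * (1 - y + y ^+ 2) <= 1 - y + y ^+ 2.
  by rewrite -[leRHS]mul1r ler_wpM2r//; nra.
have h3 : expR (- y) * (1 + y) * (1 - y + y ^+ 2) = expR (- y) * (1 + y ^+ 3) by ring.
have h4 : expR (- y) <= expR (- y) * (1 + y ^+ 3).
  by rewrite ler_peMr ?(ltW e0)// lerDl exprn_ge0.
lra.
Qed.

Lemma measurable_expRN l (A : set T) :
  measurable_fun A (fun x : R => expR (- (l * x))).
Proof.
by apply: measurableT_comp => //; apply: measurable_funN; exact: measurable_funM.
Qed.

Lemma measurable_cexp l (A : set T) : measurable_fun A (cexp l).
Proof.
apply: measurable_funD; last exact: measurable_funM.
by apply: measurable_funB => //; exact: measurable_expRN.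
Qed.

(** Taylor's formula with integral remainder. It is the source of the factor l^2 in psi: integrated
    against [Pi], (x - z)^+ becomes [Upsilon_bar pi z]. *)
Lemma integral_cexp l x : 0 < x ->
  (\int[mu]_(z in D) (l ^+ 2 * expR (- (l * z)) * Num.max 0 (x - z))%:E
   = (cexp l x)%:E)%E.
Proof.
move=> x0; pose f z : R := l ^+ 2 * expR (- (l * z)) * (x - z).
transitivity (\int[mu]_(z in `[0%R, x]) (f z)%:E)%E.
  rewrite -integral_itv_obnd_cbnd; last first.
    apply/measurable_EFinP; apply: measurable_funM.
      by apply: measurable_funM => //; exact: measurable_expRN.
    exact: measurable_funB.
  rewrite integral_mkcond [RHS]integral_mkcond; apply: eq_integral => z _.
  rewrite !patchE !mem_setE/= !in_itv/= andbT.
  have [z0|//] := ltP 0 z; have [zx|xz] /= := leP z x.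
    by rewrite /f (max_idPr _)// subr_ge0.
  by rewrite (max_idPl _) ?mulr0// subr_le0 ltW.
pose G z : R := expR (- l * z) * (1 - l * (x - z)).
have dG z : is_derive z 1 G (f z).
  by apply: is_derive_eq; rewrite /f !mulNr /GRing.scale/=; ring.
have cG : continuous G.
  move=> z; apply/differentiable_continuous/derivable1_diffP.
  by have [] := dG z.
rewrite (@continuous_FTC2 _ f G)//.
- rewrite -EFinB /G /cexp; congr (_%:E).
  by rewrite subrr !mulr0 !subr0 expR0 mulNr; ring.
- apply: continuous_subspaceT => z.
  by apply/differentiable_continuous/derivable1_diffP; exact: ex_derive.
- split; [|exact/cvg_at_right_filter/cG|exact/cvg_at_left_filter/cG].
  by move=> z _; have [] := dG z.
- by move=> z _; rewrite derive1E; have /@derive_val := dG z.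
Qed.

(** Common majorant for the integrals against [Pi]: the first term is integrable by the Levy
    condition, the second because [Upsilon_bar] is finite at 1/2. For x >= 1 the second alone is 2 x
    - 1 >= x. *)
Definition levy_dominant x : R := Num.min 1 (x ^+ 2) + 2 * Num.max 0 (x - 2^-1).

Lemma levy_dominant_ge x : 0 < x ->
  x ^+ 2 <= levy_dominant x \/ 1 <= x /\ x <= levy_dominant x.
Proof.
move=> x0; rewrite /levy_dominant; have [x1|x1] := leP x 1.
  left; rewrite (min_idPr _); last by nra.
  by rewrite lerDl mulr_ge0// le_max lexx.
right; split; first exact: ltW.
rewrite (min_idPl _); last by nra.
by rewrite (max_idPr _); lra.
Qed.

Lemma cexp_le_dominant l x : 0 < l -> 0 < x ->
  cexp l x <= (l ^+ 2 + l) * levy_dominant x.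
Proof.
move=> l0 x0; have lx : 0 <= l * x by rewrite mulr_ge0// ltW.
have h1 := cexp_le_sqr lx; have h2 := cexp_le_lin lx.
have [h|[x1 h]] := levy_dominant_ge x0.
  apply: (le_trans h1); rewrite exprMn mulrDl.
  have := ler_wpM2l (sqr_ge0 l) h; have := mulr_ge0 (ltW l0) (le_trans (sqr_ge0 x) h).
  lra.
apply: (le_trans h2); rewrite mulrDl.
have := ler_wpM2l (ltW l0) h; have := mulr_ge0 (sqr_ge0 l) (le_trans ler01 (le_trans x1 h)).
lra.
Qed.

End compensated_exponential.

(** * The Laplace exponent *)

Section laplace_exponent.
Context {R : realType}.
Local Notation T := (measurableTypeR R).
Local Notation mu := (@lebesgue_measure R).
Local Notation D := (`]0%R, +oo[%classic : set (measurableTypeR R)).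
Implicit Types (x y z l : R).
Variables (Pi : {measure set T -> \bar R}) (pi : R -> R).
Hypotheses (lPi : levy_measure Pi) (ppi : positive_density Pi pi).
Hypothesis U0 : forall x, 0 < x -> 0 < Upsilon_bar pi x.

Lemma integrable_levy_dominant : Pi.-integrable D (EFin \o levy_dominant).
Proof.
have m := @measurable_pos R; have half : 0 < 2^-1 :> R by rewrite invr_gt0.
have i1 : Pi.-integrable D (fun x => (Num.min 1 (x ^+ 2))%:E).
  apply/integrableP; split.
    apply/measurable_EFinP; apply: measurable_minr => //; exact: measurable_funX.
  have [_ h] := lPi; apply: le_lt_trans h.
  rewrite le_eqVlt; apply/orP; left; apply/eqP; apply: eq_integral => x _.
  by rewrite gee0_abs// lee_fin le_min ler01 sqr_ge0.
have i2 : Pi.-integrable D (fun x => (Num.max 0 (x - 2^-1))%:E).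
  apply/integrableP; split.
    by apply/measurable_EFinP; apply: measurable_maxr => //; exact: measurable_funB.
  rewrite (_ : (\int[Pi]_(x in D) _)%E = (Upsilon_bar pi 2^-1)%:E) ?ltry//.
  rewrite (Upsilon_barE lPi ppi half (U0 half)); apply: eq_integral => x _.
  by rewrite gee0_abs// lee_fin le_max lexx.
exact: (integrableD m i1 (integrableZl m 2 i2)).
Qed.

Lemma integrable_levy_le (f : R -> R) c : measurable_fun D f ->
  (forall x, 0 < x -> `|f x| <= c * levy_dominant x) ->
  Pi.-integrable D (EFin \o f).
Proof.
move=> mf fc; have m := @measurable_pos R.
apply: (le_integrable m _ _ (integrableZl m c integrable_levy_dominant)).
  exact/measurable_EFinP.
move=> x /posP x0; rewrite /= lee_fin (le_trans (fc x x0))//.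
exact: ler_norm.
Qed.

Lemma integrable_cexp l : 0 < l -> Pi.-integrable D (EFin \o cexp l).
Proof.
move=> l0; apply: (@integrable_levy_le _ (l ^+ 2 + l)).
  exact: measurable_cexp.
by move=> x x0; rewrite ger0_norm ?cexp_ge0// cexp_le_dominant.
Qed.

Lemma Upsilon_bar_nonincreasing x y : 0 < x -> x <= y ->
  Upsilon_bar pi y <= Upsilon_bar pi x.
Proof.
move=> x0 xy; have y0 := lt_le_trans x0 xy.
have mm z : measurable_fun D (fun x => (Num.max 0 (x - z))%:E).
  by apply/measurable_EFinP; apply: measurable_maxr => //; exact: measurable_funB.
rewrite -lee_fin !(Upsilon_barE lPi ppi)// ?U0//.
have m := @measurable_pos R; apply: ge0_le_integral => //.
  by move=> z _; rewrite lee_fin le_max lexx.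
by move=> z _; rewrite lee_fin ge_max !le_max lexx/= lerB// orbT.
Qed.

Lemma laplace_Upsilon_bar l : measurable_fun D (Upsilon_bar pi) /\
  (\int[mu]_(z in D) (l ^+ 2 * (expR (- (l * z)) * Upsilon_bar pi z))%:E =
   \int[Pi]_(x in D) (cexp l x)%:E)%E.
Proof.
have mm z : measurable_fun D (fun x => (Num.max 0 (x - z))%:E).
  by apply/measurable_EFinP; apply: measurable_maxr => //; exact: measurable_funB.
(* The weight is left general because it is used twice: [a = 1] yields the measurability of
   [Upsilon_bar pi], and a(z) = l^2 e^(-l z) the identity. *)
have main (a : R -> R) : measurable_fun setT a -> (forall z, 0 <= a z) ->
    (\int[mu]_(z in D) (a z * Upsilon_bar pi z)%:E =
     \int[Pi]_(x in D) \int[mu]_(z in D) (a z * Num.max 0 (x - z))%:E)%E /\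
    measurable_fun D (fun z => (a z * Upsilon_bar pi z)%:E).
  move=> ma a0.
  pose f (p : T * T) : \bar R := (if (0 < p.1) && (0 < p.2) then
    a p.1 * Num.max 0 (p.2 - p.1) else 0)%:E.
  have f0 p : (0 <= f p)%E.
    by rewrite lee_fin; case: ifP => // _; rewrite mulr_ge0// le_max lexx.
  have mf : measurable_fun setT f.
    apply/measurable_EFinP; apply: measurable_fun_ifT => //.
      by apply: measurable_and; apply: measurable_fun_ltr.
    apply: measurable_funM; first exact: measurableT_comp.
    by apply: measurable_maxr => //; exact: measurable_funB.
  have [tE mF] := sigma_finite_tonelli (levy_sigma_finite lPi) mf f0.
  have fE z : 0 < z -> (\int[Pi]_x f (z, x) = (a z * Upsilon_bar pi z)%:E)%E.
    move=> z0; rewrite integral_pos_support//; last first.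
      by move=> x x0; rewrite /f/= [0 < x]ltNge x0 andbF.
    rewrite EFinM (Upsilon_barE lPi ppi z0 (U0 z0)) -ge0_integralZl_EFin//.
    - by apply: eq_integral => x /in_posP x0; rewrite /f/= z0 x0.
    - by move=> x _; rewrite lee_fin le_max lexx.
  split; last first.
    by apply: eq_measurable_fun (measurable_funTS mF) => z /in_posP; exact: fE.
  transitivity (\int[mu]_z \int[Pi]_x f (z, x))%E.
    rewrite integral_mkcond; apply: eq_integral => z _; rewrite patchE.
    case: ifPn => [/in_posP z0|]; first by rewrite fE.
    rewrite mem_setE/= in_itv/= andbT => z0; rewrite integral0_eq// => x _.
    by rewrite /f/= (negbTE z0).
  rewrite tE integral_pos_support//; last first.
    by move=> x x0; apply: integral0_eq => z _; rewrite /f/= [0 < x]ltNge x0 andbF.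
  apply: eq_integral => x /in_posP x0; rewrite [RHS]integral_mkcond.
  apply: eq_integral => z _; rewrite patchE /f/= x0 andbT.
  by rewrite mem_setE/= in_itv/= andbT; case: ifP.
split.
  have [_ h] := main (cst 1) (measurable_cst _) (fun=> ler01).
  apply/measurable_EFinP; apply: eq_measurable_fun h => z _.
  by rewrite /= mul1r.
have ma : measurable_fun setT (fun z => l ^+ 2 * expR (- (l * z))).
  by apply: measurable_funM => //; exact: measurable_expRN.
have [|h _] := main _ ma; first by move=> z; rewrite mulr_ge0 ?sqr_ge0 ?expR_ge0.
under eq_integral do rewrite mulrA.
by rewrite h; apply: eq_integral => x /in_posP x0; rewrite integral_cexp.
Qed.

Lemma laplace_finite_Upsilon_bar : laplace_finite (Upsilon_bar pi).
Proof.
have mU : measurable_fun D (Upsilon_bar pi) := (laplace_Upsilon_bar 1).1.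
split=> [//|x x0|l l0]; first exact/ltW/U0.
have l2 : 0 < l ^+ 2 by rewrite exprn_gt0.
have mE : measurable_fun D (EFin \o (fun z => expR (- (l * z)) * Upsilon_bar pi z)).
  by apply/measurable_EFinP; apply: measurable_funM => //; exact: measurable_expRN.
have := integrable_lty (measurable_pos) (integrable_cexp l0).
rewrite -(laplace_Upsilon_bar l).2.
under eq_integral do rewrite EFinM.
have m := @measurable_pos R; rewrite ge0_integralZl_EFin//; last exact: ltW.
- move: (\int[mu]_(x in D) _)%E => [r _|/=|//]; first exact: ltry.
  by rewrite gt0_muley// lte_fin.
- by move=> x /posP x0; rewrite lee_fin mulr_ge0 ?expR_ge0// ltW// U0.
Qed.

Lemma mom_Upsilon_bar l : 0 < l ->
  l ^+ 2 * mom (Upsilon_bar pi) l 0 = \int[Pi]_(x in D) cexp l x.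
Proof.
move=> l0; have i := integrable_kern 0 laplace_finite_Upsilon_bar l0.
rewrite /mom -RintegralZl//.
rewrite /Rintegral; congr fine; rewrite -(laplace_Upsilon_bar l).2.
by apply: eq_integral => z _; rewrite kern0.
Qed.

(* This is [psi'(0+)], the mean of [X 1]. *)
Definition levy_drift gamma : R :=
  gamma - \int[Pi]_(x in D) (x - x * \1_`]0, 1[ x).

(** Compensating the jumps of size at least 1 as well moves their mean into the linear term, which
    turns [gamma] into [levy_drift gamma]; the remaining integral of [cexp] is l^2 times a Laplace
    transform. *)
Lemma triplet_exponentE gamma sigma l : 0 < l ->
  triplet_exponent gamma sigma Pi l = levy_drift gamma * l +
    2^-1 * sigma ^+ 2 * l ^+ 2 + l ^+ 2 * mom (Upsilon_bar pi) l 0.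
Proof.
move=> l0; rewrite mom_Upsilon_bar// /triplet_exponent /levy_drift.
have m := @measurable_pos R; have ic := integrable_cexp l0.
have mind : measurable_fun D (fun x : R => \1_(`]0, 1[%classic : set R) x : R).
  by apply: measurable_indic; exact: measurable_itv.
have it : Pi.-integrable D (EFin \o (fun x => x - x * \1_`]0, 1[ x)).
  apply: (@integrable_levy_le _ 1).
    by apply: measurable_funB => //; exact: measurable_funM.
  move=> x x0; rewrite mul1r indicE mem_setE/= in_itv/= x0/=.
  have d0 : 0 <= levy_dominant x.
    have [h|[h1 h2]] := levy_dominant_ge x0; last lra.
    exact: le_trans (sqr_ge0 x) h.
  have [x1|x1] := ltP x 1; first by rewrite mulr1 subrr normr0.
  rewrite mulr0 subr0 gtr0_norm//.
  by have [h|[]//] := levy_dominant_ge x0; nra.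
have -> : \int[Pi]_(x in D) (1 - expR (- (l * x)) - l * x * \1_`]0, 1[ x) =
    l * \int[Pi]_(x in D) (x - x * \1_`]0, 1[ x) - \int[Pi]_(x in D) cexp l x.
  rewrite -(RintegralZl _ m it) -RintegralB//; last exact: (integrableZl m _ it).
  by apply: eq_Rintegral => x _; rewrite /cexp; ring.
by ring.
Qed.

(** The drift is the limit of psi(e) / e > 0 along e = 1 / (n + 1). The jump part vanishes by
    dominated convergence: cexp(e, x) / e is at most e x^2, hence tends to 0, and is bounded by
    [levy_dominant x] uniformly in e <= 1. *)
Lemma levy_drift_ge0 gamma sigma :
  (forall l, 0 < l -> 0 < triplet_exponent gamma sigma Pi l) ->
  0 <= levy_drift gamma.
Proof.
move=> psi0; have m := @measurable_pos R.
pose e n : R := n.+1%:R^-1.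
have e0 n : 0 < e n by rewrite invr_gt0.
have e1 n : e n <= 1 by rewrite invf_le1// ler1n.
have ecvg : e n @[n --> \oo] --> (0 : R) by exact: cvg_harmonic.
pose f n x := cexp (e n) x / e n.
have fdom n x : 0 < x -> 0 <= f n x <= levy_dominant x /\ f n x <= e n * x ^+ 2.
  move=> x0; rewrite divr_ge0 ?cexp_ge0 ?(ltW (e0 n))//=.
  have ex : 0 <= e n * x by rewrite mulr_ge0// ltW.
  have h1 : f n x <= e n * x ^+ 2.
    rewrite ler_pdivrMr// (le_trans (cexp_le_sqr ex))// exprMn.
    by rewrite [leRHS]mulrAC -expr2.
  have h2 : f n x <= x.
    by rewrite ler_pdivrMr// (le_trans (cexp_le_lin ex))// mulrC.
  split=> //; have [h|[_ h]] := levy_dominant_ge x0; last exact: le_trans h.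
  by apply: le_trans h; apply: (le_trans h1); rewrite ler_piMl ?sqr_ge0.
have mf n : measurable_fun D (f n).
  by apply: measurable_funM => //; exact: measurable_cexp.
have [] // := @dominated_convergence _ _ _ Pi _ m (fun n => EFin \o f n)
    (cst 0%E) (EFin \o levy_dominant).
- by move=> n; exact/measurable_EFinP.
- apply: aeW => x /posP x0; apply: cvg_EFin; first exact: nearW.
  apply: (@squeeze_cvgr _ _ _ _ (cst 0) (fun n => e n * x ^+ 2)).
  + apply: nearW => n; have [/andP[h1 _] h2] := fdom n x x0.
    exact/andP.
  + exact: cvg_cst.
  + by rewrite -(mul0r (x ^+ 2)); apply: cvgM ecvg (cvg_cst _).
- exact: integrable_levy_dominant.
- apply: aeW => x n /posP x0; have [/andP[h1 h2] _] := fdom n x x0.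
  by rewrite /= lee_fin ger0_norm.
rewrite integral0 => _ _ /fine_cvgP[_ fc].
have : levy_drift gamma + 2^-1 * sigma ^+ 2 * e n + \int[Pi]_(x in D) f n x
    @[n --> \oo] --> levy_drift gamma + 2^-1 * sigma ^+ 2 * 0 + 0.
  apply: cvgD fc; apply: cvgD; first exact: cvg_cst.
  by apply: cvgM ecvg; exact: cvg_cst.
rewrite mulr0 !addr0 => h; apply: (ler_cvg_to (cvg_cst 0) h).
apply: nearW => n; have := psi0 (e n) (e0 n).
rewrite triplet_exponentE// mom_Upsilon_bar//.
have -> : \int[Pi]_(x in D) f n x = (\int[Pi]_(x in D) cexp (e n) x) / e n.
  by rewrite /f RintegralZr//; exact: integrable_cexp.
move: (Rintegral _ _ _) => I hI.
have -> : levy_drift gamma + 2^-1 * sigma ^+ 2 * e n + I / e n =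
    (levy_drift gamma * e n + 2^-1 * sigma ^+ 2 * e n ^+ 2 + I) / e n.
  by field; rewrite gt_eqF.
by rewrite divr_ge0 ?ltW.
Qed.

End laplace_exponent.

Theorem theorem2p1 (R : realType) (d : measure_display) (T : measurableType d)
    (P : probability T R) (X : R -> {RV P >-> R})
    (gamma sigma : R) (Pi : {measure set (measurableTypeR R) -> \bar R})
    (pi : R -> R) (Phi0 : R) (W : R -> R) :
  spectrally_negative_levy X ->
  has_triplet X gamma sigma Pi ->
  positive_density Pi pi ->
  largest_root (triplet_exponent gamma sigma Pi) Phi0 ->
  Phi0 = 0 ->
  scale_function (triplet_exponent gamma sigma Pi) Phi0 W ->
  log_convex_on `]0, +oo[ (Upsilon_bar pi) ->
  concave_on `]0, +oo[ W.
Proof.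
move=> _ [_ lPi _] ppi [_ _ root] Phi00 [W0 _ Wc Wnd WL] [U0' Uc].
rewrite {}Phi00 in root WL; set psi := triplet_exponent gamma sigma Pi in root WL.
have U0 x : 0 < x -> 0 < Upsilon_bar pi x.
  by move=> x0; apply: U0'; rewrite /= in_itv/= andbT.
have [Wc' _] := (continuous_within_itvcyP 0 W).1 Wc.
have W_cont x : 0 < x -> {for x, continuous W}.
  by move=> x0; apply: Wc'; rewrite in_itv/= andbT.
have mW : measurable_fun (`]0, +oo[%classic : set (measurableTypeR R)) W.
  apply: open_continuous_measurable_fun => // x; rewrite inE/= in_itv/= andbT.
  exact: W_cont.
have WD l : 0 < l -> (\int[lebesgue_measure]_(x in `]0%R, +oo[)
    (expR (- (l * x)) * W x)%:E)%E = (psi l)^-1%:E.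
  move=> l0; rewrite -WL// integral_itv_obnd_cbnd//.
  by apply/measurable_EFinP; apply: measurable_funM => //; exact: measurable_expRN.
have Wl : laplace_finite W.
  by split=> // l l0; rewrite WD// ltry.
have momW l : 0 < l -> mom W l 0 = (psi l)^-1.
  move=> l0; have := WD l l0; rewrite /mom /Rintegral => e.
  by under eq_integral do rewrite kern0; rewrite e.
(* The sign comes from 1 / psi being the transform of [W >= 0]. As the inverse of 0 is 0, this
   leaves psi(l) = 0 possible; the largest root being 0 excludes it. *)
have psi0 l : 0 < l -> 0 < psi l.
  move=> l0; rewrite lt_neqAle -invr_ge0 -momW// mom_ge0// andbT eq_sym.
  by apply/negP => /eqP/(root _ (ltW l0)); rewrite leNgt l0.
apply: (@inverse_concave R (Upsilon_bar pi) W (2^-1 * sigma ^+ 2) (levy_drift Pi gamma)).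
- by rewrite mulr_ge0 ?sqr_ge0// invr_ge0.
- exact: levy_drift_ge0 lPi ppi U0 _ _ psi0.
- exact: laplace_finite_Upsilon_bar lPi ppi U0.
- exact: U0.
- exact: Upsilon_bar_nonincreasing lPi ppi U0.
- exact: Uc.
- exact: Wl.
- by move=> x y x0 xy; apply: Wnd => //; rewrite in_itv/= andbT ltW// (lt_le_trans x0).
- exact: W_cont.
move=> l l0; rewrite momW//.
rewrite (_ : l ^+ 2 * _ = psi l) ?divff ?gt_eqF ?psi0//.
rewrite /psi (triplet_exponentE lPi ppi U0 gamma sigma l0).
by field; rewrite gt_eqF.
Qed.
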